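(* Let $N=2n$ and $m\ge1$. The image of the formal series $$\mathrm{tr}\,S^{(m)}T_1(u)\,T_2(u+1)\cdots T_m(u+m-1)$$ with coefficients in $\mathrm Y(\mathfrak o_N)^{\mathfrak h}$ (trace over all $m$ copies of $\mathrm{End}\,\mathbb C^N$) under the Harish-Chandra homomorphism of the Yangian $\mathrm Y(\mathfrak o_N)$ is $$\sum_{1\le i_1\le\dots\le i_m\le N}\lambda_{i_1}(u)\,\lambda_{i_2}(u+1)\cdots\lambda_{i_m}(u+m-1)$$ with the condition that $n$ and $n'=n+1$ do not occur simultaneously among the summation indices $i_1,\dots,i_m$.
   Context: Put $i'=N-i+1$, $\kappa=N/2-1$, $P=\sum e_{ij}\otimes e_{ji}$, $Q=\sum e_{ij}\otimes e_{i'j'}$ in $\mathrm{End}\,\mathbb C^N\otimes\mathrm{End}\,\mathbb C^N$ and $R(u)=1-\frac{P}{u}+\frac{Q}{u-\kappa}$. The Yangian $\mathrm Y(\mathfrak o_N)$ is the associative algebra with generators $t_{ij}^{(r)}$ ($1\le i,j\le N$, $r\ge1$); with $t_{ij}(u)=\delta_{ij}+\sum_{r\ge1}t_{ij}^{(r)}u^{-r}$ and $T(u)=\sum e_{ij}\otimes t_{ij}(u)$, the defining relations are $R_{12}(u-v)T_1(u)T_2(v)=T_2(v)T_1(u)R_{12}(u-v)$ and $T'(u+\kappa)T(u)=1$, where $(A')_{ij}=A_{j'i'}$ and $T_a(u)$ denotes $T(u)$ with its matrix part in the $a$-th copy of $\mathrm{End}\,\mathbb C^N$. $\mathfrak o_N$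 is spanned by $F_{ij}=E_{ij}-E_{j'i'}$; $\mathrm U(\mathfrak o_N)$ is embedded in $\mathrm Y(\mathfrak o_N)$ by $F_{ij}\mapsto t_{ij}^{(1)}$; $\mathfrak h=\mathrm{span}(F_{11},\dots,F_{nn})$, and $\mathrm Y(\mathfrak o_N)^{\mathfrak h}$ is the subalgebra of $\mathfrak h$-invariants under the adjoint action. Harish-Chandra homomorphism: let $I$ be the left ideal of $\mathrm Y(\mathfrak o_N)$ generated by all $t_{ij}^{(r)}$ with $i<j$, $r\ge1$. Then $\mathrm Y(\mathfrak o_N)^{\mathfrak h}\cap I$ is a two-sided ideal of $\mathrm Y(\mathfrak o_N)^{\mathfrak h}$, the quotient is the polynomial algebra freely generated by the images $\lambda_i^{(r)}$ of $t_{ii}^{(r)}$, $1\le i\le n$, $r\ge1$, and the homomorphism is the quotient map $\mathrm Y(\mathfrak o_N)^{\mathfrak h}\to\mathbb C[\lambda_i^{(r)}\mid 1\le i\le n,\ r\ge1]$, applied coefficientwise to series. For all $i=1,\dots,N$, $\lambda_i(u)=1+\sum_{r\ge1}\lambda_i^{(r)}u^{-r}$ denotes the image of $t_{ii}(u)$. With $P_{ab},Q_{ab}$ denoting $P,Q$ acting in copies $a,b$ of $(\mathrm{End}\,\mathbb C^N)^{\otimes m}$, $S^{(1)}=1$ and for $m\ge2$ $S^{(m)}=\frac1{m!}\prod_{1\le a<b\le m}\big(1+\frac{P_{ab}}{b-a}-\frac{Q_{ab}}{N/2+b-a-1}\big)$, product in lexicographic order on the pairs $(a,b)$. *)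

(* Defs.v *)
From HB Require Import structures.
From mathcomp Require Import ssrAC all_boot all_order all_algebra.
From mathcomp Require Import generic_quotient ring_quotient.
From mathcomp Require Import finmap boolp reals complex.
From mathcomp.multinomials Require Import monalg.

Set Implicit Arguments.
Unset Strict Implicit.
Unset Printing Implicit Defensive.

Import GRing.Theory.
Local Open Scope ring_scope.

(* A formal series sum_r f_r u^{-r} over B is represented by its coefficient
   sequence f : nat -> B. *)

Section Series.

Definition sconv (B : pzSemiRingType) (f g : nat -> B) : nat -> B :=
  fun r => \sum_(k < r.+1) f k * g (r - k)%N.

Definition sone (B : pzSemiRingType) : nat -> B := fun r => (r == 0%N)%:R.

(* f(u + c): with r = s + k, the coefficient of u^{-r} in (u + c)^{-s} is
   binom(-s, k) c^k = binom(r - 1, k) (-c)^k. *)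
Definition sshift (F : fieldType) (V : lmodType F) (c : F) (f : nat -> V) :
    nat -> V :=
  fun r => \sum_(s < r.+1) ('C(r.-1, (r - s)%N)%:R * (- c) ^+ (r - s)%N) *: f s.

End Series.

(* B (x) (End C^N)^{(x) m} is the ring of matrices over B whose rows and columns
   are indexed by the basis {1..N}^m of (C^N)^{(x) m}; the indices 1..N and the
   copies 1..m are counted from 0, and i' is rev_ord i. *)

Section Tensors.
Variables (N m : nat).

Definition tbasis : finType := {ffun 'I_m -> 'I_N}.

Definition tindex (x : 'I_#|tbasis|) : {ffun 'I_m -> 'I_N} := enum_val x.

Section Units.
Variable B : pzRingType.

(* e_ij acting in the copy a. *)
Definition eop (a : 'I_m) (i j : 'I_N) : 'M[B]_(#|tbasis|) :=
  \matrix_(x, y)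
    [&& tindex x a == i, tindex y a == j
      & [forall b, (b != a) ==> (tindex x b == tindex y b)]]%:R.

Definition Pop (a b : 'I_m) : 'M[B]_(#|tbasis|) :=
  \sum_i \sum_j eop a i j *m eop b j i.

Definition Qop (a b : 'I_m) : 'M[B]_(#|tbasis|) :=
  \sum_i \sum_j eop a i j *m eop b (rev_ord i) (rev_ord j).

Definition Top (a : 'I_m) (t : 'I_N -> 'I_N -> nat -> B) (r : nat) :
    'M[B]_(#|tbasis|) :=
  \sum_i \sum_j t i j r *: eop a i j.

End Units.

Definition Ssym (F : fieldType) : 'M[F]_(#|tbasis|) :=
  (m`!%:R)^-1 *:
  \prod_(a < m) \prod_(b < m | (a < b)%N)
    (1 + (b - a)%N%:R^-1 *: Pop F a b
       - (N%:R / 2 + (b - a)%N%:R - 1)^-1 *: Qop F a b).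

End Tensors.

Section Relations.
Variables (F : fieldType) (N : nat).

Definition kappa : F := N%:R / 2 - 1.

Section Defects.
Variables (B : algType F) (t : 'I_N -> 'I_N -> nat -> B).

Local Notation E2 := ('M[B]_(#|tbasis N 2|)).

(* Series sum_{r,s} G_{r,s} u^{-r} v^{-s}, with r, s bounded below, are
   represented by G : int -> int -> E2, and (u - v - c) G by umv c G.  The RTT
   relation is multiplied by the central element (u - v)(u - v - kappa):
   (u - v)(u - v - kappa) R(u - v)
     = (u - v)(u - v - kappa) - (u - v - kappa) P + (u - v) Q. *)
Definition umv (c : F) (G : int -> int -> E2) : int -> int -> E2 :=
  fun r s => G (r + 1) s - G r (s + 1) - c%:A *: G r s.

Definition Rleft (G : int -> int -> E2) : int -> int -> E2 := fun r s =>
  umv 0 (umv kappa G) r s - Pop N B ord0 ord_max *m umv kappa G r s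
    + Qop N B ord0 ord_max *m umv 0 G r s.

Definition Rright (G : int -> int -> E2) : int -> int -> E2 := fun r s =>
  umv 0 (umv kappa G) r s - umv kappa G r s *m Pop N B ord0 ord_max
    + umv 0 G r s *m Qop N B ord0 ord_max.

Definition zext (f : nat -> E2) : int -> E2 :=
  fun r => if r is Posz k then f k else 0.

Definition T12 (r s : int) : E2 :=
  zext (Top ord0 t) r *m zext (Top ord_max t) s.

Definition T21 (r s : int) : E2 :=
  zext (Top ord_max t) s *m zext (Top ord0 t) r.

Definition rtt_defect (r s : int) : E2 := Rleft T12 r s - Rright T21 r s.

Definition unit_defect (r : nat) : 'M[B]_N :=
  sconv (fun k => \matrix_(i, j)
           sshift kappa (t (rev_ord j) (rev_ord i)) k)
        (fun k => \matrix_(i, j) t i j k) r - sone _ r.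

Definition defect (x : B) : Prop :=
  (exists r s i j, x = rtt_defect r s i j) \/
  (exists r i j, x = unit_defect r i j).

End Defects.

Section Naturality.
Variables (B B' : algType F) (f : {lrmorphism B -> B'}).

Let map_alg (c : F) : f c%:A = c%:A.
Proof. by rewrite linearZ /= rmorph1. Qed.

Lemma map_eop m a i j : map_mx f (eop B a i j) = eop B' a i j :> 'M_(#|tbasis N m|).
Proof. by apply/matrixP=> x y; rewrite !mxE rmorph_nat. Qed.

Lemma map_Pop m a b : map_mx f (Pop N B a b) = Pop N B' a b :> 'M_(#|tbasis N m|).
Proof.
rewrite /Pop raddf_sum; apply: eq_bigr=> i _; rewrite raddf_sum.
by apply: eq_bigr=> j _; rewrite /= map_mxM !map_eop.
Qed.

Lemma map_Qop m a b : map_mx f (Qop N B a b) = Qop N B' a b :> 'M_(#|tbasis N m|).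
Proof.
rewrite /Qop raddf_sum; apply: eq_bigr=> i _; rewrite raddf_sum.
by apply: eq_bigr=> j _; rewrite /= map_mxM !map_eop.
Qed.

Lemma map_Top m (a : 'I_m) (t : 'I_N -> 'I_N -> nat -> B) r :
  map_mx f (Top a t r) = Top a (fun i j k => f (t i j k)) r.
Proof.
rewrite /Top raddf_sum; apply: eq_bigr=> i _; rewrite raddf_sum.
by apply: eq_bigr=> j _; rewrite /= map_mxZ map_eop.
Qed.

Lemma map_umv c G r s :
  map_mx f (umv c G r s) = umv c (fun r s => map_mx f (G r s)) r s.
Proof. by rewrite /umv !raddfB /= map_mxZ; congr (_ - _ *: _); apply: map_alg. Qed.

Lemma map_T12 t :
  (fun r s => map_mx f (T12 t r s)) = T12 (fun i j k => f (t i j k)).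
Proof.
apply/funext=> r; apply/funext=> s; rewrite /T12 map_mxM.
by case: r s => [?|?] [?|?] /=; rewrite ?map_Top ?map_mx0.
Qed.

Lemma map_T21 t :
  (fun r s => map_mx f (T21 t r s)) = T21 (fun i j k => f (t i j k)).
Proof.
apply/funext=> r; apply/funext=> s; rewrite /T21 map_mxM.
by case: r s => [?|?] [?|?] /=; rewrite ?map_Top ?map_mx0.
Qed.

Let map_umvE c G :
  (fun r s => map_mx f (umv c G r s)) = umv c (fun r s => map_mx f (G r s)).
Proof. by apply/funext=> r; apply/funext=> s; rewrite map_umv. Qed.

Let map_Rleft G r s :
  map_mx f (Rleft G r s) = Rleft (fun r s => map_mx f (G r s)) r s.
Proof.
rewrite {1}/Rleft map_mxD map_mxB !map_mxM !map_umv map_umvE.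
by rewrite map_Pop map_Qop.
Qed.

Let map_Rright G r s :
  map_mx f (Rright G r s) = Rright (fun r s => map_mx f (G r s)) r s.
Proof.
rewrite {1}/Rright map_mxD map_mxB !map_mxM !map_umv map_umvE.
by rewrite map_Pop map_Qop.
Qed.

Lemma map_rtt_defect t r s :
  map_mx f (rtt_defect t r s) = rtt_defect (fun i j k => f (t i j k)) r s.
Proof.
by rewrite /rtt_defect map_mxB map_Rleft map_Rright map_T12 map_T21.
Qed.

Lemma map_unit_defect t r :
  map_mx f (unit_defect t r) = unit_defect (fun i j k => f (t i j k)) r.
Proof.
rewrite /unit_defect raddfB /= /sconv raddf_sum; congr (_ - _); last first.
  by rewrite /sone rmorph_nat.
apply: eq_bigr=> k _; rewrite /= -mulmxE map_mxM; congr (_ *m _).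
  apply/matrixP=> i j; rewrite !mxE /sshift raddf_sum.
  by apply: eq_bigr=> s _; exact: linearZ.
by apply/matrixP=> i j; rewrite !mxE.
Qed.

Lemma map_defect t x : defect t x -> defect (fun i j k => f (t i j k)) (f x).
Proof.
case=> [[r [s [i [j ->]]]]|[r [i [j ->]]]].
  by left; exists r, s, i, j; rewrite -map_rtt_defect [RHS]mxE.
by right; exists r, i, j; rewrite -map_unit_defect [RHS]mxE.
Qed.

End Naturality.
End Relations.

Section TrivialSolution.
Variables (F : fieldType) (N : nat).

Local Notation triv := (fun i j : 'I_N => fun r : nat =>
  ((i == j) && (r == 0))%:R : F^o).

Lemma sum_eop (B : pzRingType) m (a : 'I_m) :
  \sum_i eop B a i i = 1%:M :> 'M_(#|tbasis N m|).
Proof.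
apply/matrixP=> x y; rewrite summxE (bigD1 (tindex x a)) //= big1 ?addr0.
  rewrite !mxE eqxx /=; congr (nat_of_bool _)%:R; apply/idP/eqP.
    case/andP=> /eqP e /forallP h; apply: enum_val_inj; apply/ffunP=> b.
    by have := h b; case: eqVneq => [-> _|_ /eqP].
  by move=> ->; rewrite eqxx; apply/forallP=> b; rewrite eqxx implybT.
by move=> i /negPf ni; rewrite !mxE eq_sym ni.
Qed.

Lemma Top_triv m (a : 'I_m) r : Top a triv r = (r == 0)%:R%:M.
Proof.
rewrite /Top -scalemx1 -(sum_eop _ a) scaler_sumr; apply: eq_bigr=> i _.
rewrite (bigD1 i) //= eqxx /= big1 ?addr0 // => j; rewrite eq_sym => /negPf ->.
by rewrite scale0r.
Qed.

Lemma triv_defect x : defect triv x -> x = 0.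
Proof.
have h (a : 'I_2) r : exists c : F^o, zext (Top a triv) r = c%:M.
  case: r => k /=; first by rewrite Top_triv; eexists.
  by exists 0; rewrite raddf0.
have [c hc] := choice (h ord0); have [d hd] := choice (h ord_max).
have scal (G : int -> int -> 'M[F^o]_(#|tbasis N 2|)) k :
    (forall r s, exists e : F^o, G r s = e%:M) ->
    forall r s, exists e : F^o, umv k G r s = e%:M.
  move=> hG r s; have [e1 E1] := hG (r + 1) s; have [e2 E2] := hG r (s + 1).
  have [e3 E3] := hG r s; rewrite /umv E1 E2 E3 scale_scalar_mx.
  by exists (e1 - e2 - (k%:A : F^o) * e3); rewrite !raddfB.
case=> [[r [s [i [j ->]]]]|[r [i [j ->]]]]; last first.
  rewrite /unit_defect; set f := (fun k => \matrix_(i, j) sshift _ _ k).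
  suff -> : sconv f (fun k => \matrix_(i0, j0) triv i0 j0 k) = sone _.
    by rewrite subrr mxE.
  have -> : f = sone 'M[F^o]_N.
    apply/funext=> k; apply/matrixP=> i1 j1; rewrite !mxE /sshift big_ord_recl.
    rewrite big1 ?addr0 => [|s _]; last by rewrite andbF scaler0.
    rewrite (inj_eq rev_ord_inj) subn0 eqxx andbT /sone.
    case: k => [|k] /=; last by rewrite bin_small // mul0r scale0r mxE.
    by rewrite bin0 expr0 mulr1 scale1r mulr1n mxE eq_sym.
  apply/funext=> k; rewrite /sconv big_ord_recl big1 ?addr0 => [|s _].
    rewrite subn0 mul1r; apply/matrixP=> i1 j1; rewrite !mxE /sone.
    by case: k => [|k]; rewrite ?andbT ?andbF !mxE.
  by rewrite /sone mul0r.
have E : T12 triv = T21 triv.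
  apply/funext=> p; apply/funext=> q.
  by rewrite /T12 /T21 hc hd -!scalar_mxM mulrC.
have hE p q : exists e : F^o, T21 triv p q = e%:M.
  by exists (d q * c p); rewrite /T21 hc hd scalar_mxM.
rewrite /rtt_defect /Rleft /Rright E.
have [e1 ->] := scal _ (kappa F N) hE r s.
have [e2 ->] := scal _ 0 hE r s.
by rewrite !(scalar_mxC e1) !(scalar_mxC e2) subrr mxE.
Qed.

End TrivialSolution.

Lemma malg_scalerAr (F : fieldType) (K : monomType) (k : F)
  (x y : {malg F[K]}) : k *: (x * y) = x * (k *: y).
Proof.
apply/malgP=> w; rewrite (mcoeffZ k (x * y) w) mcoeffMl mulr_sumr.
rewrite (mcoeffMlw w (fsubset_refl _) (msuppZ_le k y)).
apply: eq_bigr=> u _; rewrite mulr_sumr; apply: eq_bigr=> v _.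
by rewrite mcoeffZ mulrnAr mulrCA.
Qed.

Section Yangian.
Variables (F : fieldType) (N : nat).

(* (i, j, r) is the generator t_{ij}^{(r+1)}. *)
Definition ygens : choiceType := ('I_N * 'I_N * nat)%type.

Definition free_alg := {malg F[{fmonom ygens}]}.
HB.instance Definition _ := GRing.Lalgebra.on free_alg.

HB.instance Definition _ :=
  GRing.Lalgebra_isAlgebra.Build F free_alg (@malg_scalerAr F {fmonom ygens}).

Definition fgen (i j : 'I_N) (r : nat) : free_alg :=
  if r is k.+1 then << fmu ((i, j, k) : ygens) >> else (i == j)%:R.

Inductive two_sided_ideal (B : pzRingType) (G : B -> Prop) : B -> Prop :=
| TSgen x : G x -> two_sided_ideal G x
| TS0 : two_sided_ideal G 0
| TSD x y : two_sided_ideal G x -> two_sided_ideal G y ->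
    two_sided_ideal G (x + y)
| TSM a x b : two_sided_ideal G x -> two_sided_ideal G (a * x * b).

Definition yideal : {pred free_alg} :=
  fun x => `[< two_sided_ideal (defect fgen) x >].

Lemma yideal_zmod : zmod_closed yideal.
Proof.
split; first by apply/asboolP; apply: TS0.
move=> x y /asboolP hx /asboolP hy; apply/asboolP; apply: TSD => //.
by rewrite -(mulr1 y) -mulNr -mulN1r; apply: TSM.
Qed.
HB.instance Definition _ := GRing.isZmodClosed.Build free_alg yideal yideal_zmod.

Lemma yidealM a x b : x \in yideal -> a * x * b \in yideal.
Proof. by move=> /asboolP hx; apply/asboolP; apply: TSM. Qed.

Definition counit (x : free_alg) : F^o := x@_(mone : {fmonom ygens}).
Lemma counit_monoid : monoid_morphism counit.
Proof. by split; [apply: rmorph1|move=> x y; apply: rmorphM]. Qed.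
Lemma counit_zmod : zmod_morphism counit.
Proof. by move=> x y; apply: raddfB. Qed.
Lemma counit_scalable : scalable counit.
Proof. by move=> k x; apply: mcoeffZ. Qed.
HB.instance Definition _ :=
  GRing.isZmodMorphism.Build free_alg F^o counit counit_zmod.
HB.instance Definition _ :=
  GRing.isMonoidMorphism.Build free_alg F^o counit counit_monoid.
HB.instance Definition _ :=
  GRing.isScalable.Build F free_alg F^o *:%R counit counit_scalable.

Lemma counit_fgen i j r : counit (fgen i j r) = ((i == j) && (r == 0))%:R.
Proof.
case: r => [|r]; first by rewrite andbT rmorph_nat.
rewrite andbF /counit mcoeffU1; case: eqP => // /(congr1 (@fdeg _)).
by rewrite fdegU fdeg1.
Qed.

Lemma one_notin_yideal : 1 \notin yideal.
Proof.
apply/negP=> /asboolP h; have: counit 1 = 0.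
  elim: h => [x /(map_defect counit)||x y _ hx _ hy|a x b _ hx].
  - rewrite (_ : (fun i j k => _) = fun i j k => ((i == j) && (k == 0))%:R).
      exact: triv_defect.
    by apply/funext=> i; apply/funext=> j; apply/funext=> k; rewrite -counit_fgen.
  - exact: raddf0.
  - by rewrite raddfD /= hx hy addr0.
  - by rewrite !rmorphM /= hx mulr0 mul0r.
by rewrite rmorph1 => /eqP; rewrite oner_eq0.
Qed.

Local Open Scope quotient_scope.

Definition yangian := Quotient.quot yideal.
HB.instance Definition _ := GRing.Zmodule.on yangian.
HB.instance Definition _ := EqQuotient.on yangian.

Definition ypi (x : free_alg) : yangian := \pi_yangian x.

Lemma ypi_eq x y : (ypi x = ypi y) <-> x - y \in yideal.
Proof. by rewrite Quotient.idealrBE; split=> [e|/eqP //]; apply/eqP. Qed.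

Lemma ypiK (x : yangian) : ypi (repr x) = x.
Proof. exact: reprK. Qed.

Lemma ypiB : zmod_morphism ypi.
Proof. by move=> x y; rewrite /ypi !piE. Qed.
HB.instance Definition _ :=
  GRing.isZmodMorphism.Build free_alg yangian ypi ypiB.

Definition yone : yangian := ypi 1.
Definition ymul : yangian -> yangian -> yangian := lift_op2 yangian *%R.
Definition yscale (c : F) : yangian -> yangian := lift_op1 yangian ( *:%R c).

Lemma ypiM x y : ypi (x * y) = ymul (ypi x) (ypi y).
Proof.
rewrite /ymul; unlock.
have eK z : z - repr (ypi z) \in yideal by apply/ypi_eq; rewrite ypiK.
apply/ypi_eq; set x' := repr _; set y' := repr _.
have -> : x * y - x' * y' = 1 * (x - x') * y + x' * (y - y') * 1.
  by rewrite mul1r mulr1 mulrBl mulrBr addrA subrK.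
by apply: rpredD; apply: yidealM; apply: eK.
Qed.

Lemma ypiZ c x : ypi (c *: x) = yscale c (ypi x).
Proof.
rewrite /yscale; unlock; apply/ypi_eq.
rewrite -scalerBr -(mul1r (x - _)) scalerAl -(mulr1 (_ * _)).
by apply: yidealM; apply/ypi_eq; rewrite ypiK.
Qed.

Lemma ymulA : associative ymul.
Proof.
by move=> x y z; rewrite -(ypiK x) -(ypiK y) -(ypiK z) -!ypiM mulrA.
Qed.
Lemma ymul1 : left_id yone ymul.
Proof. by move=> x; rewrite -(ypiK x) -ypiM mul1r. Qed.
Lemma ymulr1 : right_id yone ymul.
Proof. by move=> x; rewrite -(ypiK x) -ypiM mulr1. Qed.
Lemma ymulDl : left_distributive ymul +%R.
Proof.
move=> x y z; rewrite -(ypiK x) -(ypiK y) -(ypiK z) -raddfD -!ypiM mulrDl.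
by rewrite raddfD.
Qed.
Lemma ymulDr : right_distributive ymul +%R.
Proof.
move=> x y z; rewrite -(ypiK x) -(ypiK y) -(ypiK z) -raddfD -!ypiM mulrDr.
by rewrite raddfD.
Qed.
Lemma yone_neq0 : yone != 0.
Proof.
apply/eqP; rewrite -(raddf0 ypi) => /ypi_eq.
by rewrite subr0 (negPf one_notin_yideal).
Qed.
HB.instance Definition _ := GRing.Zmodule_isNzRing.Build yangian
  ymulA ymul1 ymulr1 ymulDl ymulDr yone_neq0.

Lemma yscaleA a b x : yscale a (yscale b x) = yscale (a * b) x.
Proof. by rewrite -(ypiK x) -!ypiZ scalerA. Qed.
Lemma yscale1 : left_id 1 yscale.
Proof. by move=> x; rewrite -(ypiK x) -ypiZ scale1r. Qed.
Lemma yscaleDr : right_distributive yscale +%R.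
Proof.
move=> c x y; rewrite -(ypiK x) -(ypiK y) -raddfD -!ypiZ scalerDr.
by rewrite raddfD.
Qed.
Lemma yscaleDl x : {morph yscale^~ x : a b / a + b}.
Proof. by move=> a b; rewrite -(ypiK x) -!ypiZ scalerDl raddfD. Qed.
HB.instance Definition _ := GRing.Zmodule_isLmodule.Build F yangian
  yscaleA yscale1 yscaleDr yscaleDl.

Lemma yscaleAl (c : F) (x y : yangian) : c *: (x * y) = (c *: x) * y.
Proof.
rewrite -(ypiK x) -(ypiK y); change (yscale c (ymul (ypi (repr x)) (ypi (repr y)))
  = ymul (yscale c (ypi (repr x))) (ypi (repr y))).
by rewrite -!(ypiM, ypiZ) scalerAl.
Qed.
HB.instance Definition _ := GRing.Lmodule_isLalgebra.Build F yangian yscaleAl.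

Lemma yscaleAr (c : F) (x y : yangian) : c *: (x * y) = x * (c *: y).
Proof.
rewrite -(ypiK x) -(ypiK y); change (yscale c (ymul (ypi (repr x)) (ypi (repr y)))
  = ymul (ypi (repr x)) (yscale c (ypi (repr y)))).
by rewrite -!(ypiM, ypiZ) scalerAr.
Qed.
HB.instance Definition _ := GRing.Lalgebra_isAlgebra.Build F yangian yscaleAr.

Lemma ypi_monoid : monoid_morphism ypi.
Proof. by split; [exact: erefl|exact: ypiM]. Qed.
HB.instance Definition _ :=
  GRing.isMonoidMorphism.Build free_alg yangian ypi ypi_monoid.
Lemma ypi_scalable : scalable ypi.
Proof. by move=> c x; rewrite ypiZ. Qed.
HB.instance Definition _ :=
  GRing.isScalable.Build F free_alg yangian *:%R ypi ypi_scalable.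

Definition ygen (i j : 'I_N) (r : nat) : yangian := ypi (fgen i j r).

Lemma ygen0 i j : ygen i j 0 = (i == j)%:R.
Proof. exact: rmorph_nat. Qed.

Lemma ygen_rtt r s : rtt_defect ygen r s = 0.
Proof.
rewrite /ygen -(map_rtt_defect ypi fgen); apply/matrixP=> i j.
rewrite mxE [RHS]mxE -(raddf0 ypi); apply/ypi_eq; rewrite subr0.
by apply/asboolP; apply: TSgen; left; exists r, s, i, j.
Qed.

Lemma ygen_unit r : unit_defect ygen r = 0.
Proof.
rewrite /ygen -(map_unit_defect ypi fgen); apply/matrixP=> i j.
rewrite mxE [RHS]mxE -(raddf0 ypi); apply/ypi_eq; rewrite subr0.
by apply/asboolP; apply: TSgen; right; exists r, i, j.
Qed.

End Yangian.

Section TwoCopies.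
Variables (N : nat) (B : pzRingType).

Definition tpair (i k : 'I_N) : 'I_#|tbasis N 2| :=
  enum_rank ([ffun a : 'I_2 => if a == ord0 then i else k] : tbasis N 2).

Lemma tindex_pair i k a : tindex (tpair i k) a = if a == ord0 then i else k.
Proof. by rewrite /tindex enum_rankK ffunE. Qed.

Lemma ord2 (b : 'I_2) : b = if b == ord0 then ord0 else ord_max.
Proof. by apply/val_inj; case: b => [[|[|]]]. Qed.

Lemma sum_pair (f : 'I_#|tbasis N 2| -> B) :
  \sum_z f z = \sum_c \sum_d f (tpair c d).
Proof.
rewrite pair_bigA /= (reindex (fun p => tpair p.1 p.2)) //.
exists (fun z => (tindex z ord0, tindex z ord_max)) => [[c d] _|z _].
  by rewrite !tindex_pair.
apply/enum_val_inj/ffunP=> b; rewrite -!/(tindex _) tindex_pair /= [in RHS](ord2 b).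
by case: ifP.
Qed.

Lemma eop_pair (a : 'I_2) i j (x y z w : 'I_N) :
  eop B a i j (tpair x y) (tpair z w) =
  (if a == ord0 then [&& x == i, z == j & y == w]
   else [&& y == i, w == j & x == z])%:R.
Proof.
have E (P : pred 'I_2) : [forall b, P b] = P ord0 && P ord_max.
  apply/forallP/andP=> [h|[h0 h1] b]; first by split.
  by rewrite (ord2 b); case: ifP.
have [->|->] : a = ord0 \/ a = ord_max.
- by rewrite (ord2 a); case: ifP; [left|right].
- by rewrite mxE !tindex_pair E !tindex_pair.
- by rewrite mxE !tindex_pair E !tindex_pair /= andbT.
Qed.

Lemma eop2 i j k l (x y z w : 'I_N) :
  (eop B ord0 i j *m eop B ord_max k l) (tpair x y) (tpair z w) =
  [&& x == i, z == j, y == k & w == l]%:R.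
Proof.
rewrite mxE sum_pair (bigD1 z) //= [X in _ + X]big1 ?addr0; last first.
  move=> c /negPf nc; apply: big1 => d _.
  by rewrite !eop_pair /= nc !andbF mulr0.
rewrite (bigD1 y) //= big1 ?addr0; last first.
  by move=> d /negPf nd; rewrite !eop_pair /= [y == d]eq_sym nd !andbF mul0r.
rewrite !eop_pair /= !eqxx !andbT -natrM mulnb.
by congr (nat_of_bool _)%:R; rewrite !andbA.
Qed.

Lemma Pop_pair (x y z w : 'I_N) :
  Pop N B ord0 ord_max (tpair x y) (tpair z w) = ((x == w) && (y == z))%:R.
Proof.
rewrite summxE (bigD1 x) //= [X in _ + X]big1 ?addr0; last first.
  move=> i /negPf ni; rewrite summxE big1 // => j _.
  by rewrite eop2 [x == i]eq_sym ni.
rewrite summxE (bigD1 z) //= big1 ?addr0; last first.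
  by move=> j /negPf nj; rewrite eop2 [z == j]eq_sym nj andbF.
by rewrite eop2 !eqxx /= [w == x]eq_sym andbC.
Qed.

Lemma Qop_pair (x y z w : 'I_N) :
  Qop N B ord0 ord_max (tpair x y) (tpair z w) =
  ((y == rev_ord x) && (w == rev_ord z))%:R.
Proof.
rewrite summxE (bigD1 x) //= [X in _ + X]big1 ?addr0; last first.
  move=> i /negPf ni; rewrite summxE big1 // => j _.
  by rewrite eop2 [x == i]eq_sym ni.
rewrite summxE (bigD1 z) //= big1 ?addr0; last first.
  by move=> j /negPf nj; rewrite eop2 [z == j]eq_sym nj andbF.
by rewrite eop2 !eqxx.
Qed.

Lemma Top0_pair (t : 'I_N -> 'I_N -> nat -> B) r (x y z w : 'I_N) :
  Top ord0 t r (tpair x y) (tpair z w) = t x z r * (y == w)%:R.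
Proof.
rewrite summxE (bigD1 x) //= [X in _ + X]big1 ?addr0; last first.
  move=> i /negPf ni; rewrite summxE big1 // => j _.
  by rewrite mxE eop_pair /= [x == i]eq_sym ni mulr0.
rewrite summxE (bigD1 z) //= big1 ?addr0; last first.
  by move=> j /negPf nj; rewrite mxE eop_pair /= [z == j]eq_sym nj andbF mulr0.
by rewrite mxE eop_pair /= !eqxx.
Qed.

Lemma Top1_pair (t : 'I_N -> 'I_N -> nat -> B) r (x y z w : 'I_N) :
  Top ord_max t r (tpair x y) (tpair z w) = t y w r * (x == z)%:R.
Proof.
rewrite summxE (bigD1 y) //= [X in _ + X]big1 ?addr0; last first.
  move=> i /negPf ni; rewrite summxE big1 // => j _.
  by rewrite mxE eop_pair /= [y == i]eq_sym ni mulr0.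
rewrite summxE (bigD1 w) //= big1 ?addr0; last first.
  by move=> j /negPf nj; rewrite mxE eop_pair /= [w == j]eq_sym nj andbF mulr0.
by rewrite mxE eop_pair /= !eqxx.
Qed.

End TwoCopies.

Section Commutation.
Variables (F : fieldType) (N : nat) (B : algType F).
Variable t : 'I_N -> 'I_N -> nat -> B.
Hypothesis t0 : forall i j, t i j 0 = (i == j)%:R.
Hypothesis rtt : forall r s, rtt_defect t r s = 0.

Lemma Top_t0 (a : 'I_2) : Top a t 0 = 1%:M.
Proof.
rewrite -(sum_eop N B a) /Top; apply: eq_bigr=> i _.
rewrite (bigD1 i) //= big1 ?addr0 ?t0 ?eqxx ?scale1r // => j.
by rewrite t0 eq_sym => /negPf ->; rewrite scale0r.
Qed.

Lemma zmod_move (V : zmodType) (a a' z w p p' q q' : V) :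
  a - z - w - z - p + q - (a' - z - w - z - p' + q') = 0 ->
  a - a' = p - p' - (q - q').
Proof.
move=> /eqP; rewrite subr_eq0 => /eqP h.
have -> : a = a - z - w - z - p + q - q + p + z + w + z.
  by rewrite addrK !subrK.
rewrite h opprB (ACl ((1*12)*(2*9)*(3*10)*(4*11)*(8*5)*(6*7)))%AC /=.
by rewrite subrr !addNr !add0r.
Qed.

(* The coefficient of u v^{-s} in the RTT relation. *)
Lemma comm_T1 (s : nat) :
  let T1 := Top (ord0 : 'I_2) t 1 in let T2 := Top (ord_max : 'I_2) t s in
  let P := Pop N B ord0 ord_max in let Q := Qop N B ord0 ord_max in
  T1 *m T2 - T2 *m T1 = P *m T2 - T2 *m P - (Q *m T2 - T2 *m Q).
Proof.
move=> T1 T2 P Q; have := rtt (- 1) s; rewrite /rtt_defect /Rleft /Rright.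
have e12 x : T12 t 0 x = zext (Top ord_max t) x by rewrite /T12 /= Top_t0 mul1mx.
have e21 x : T21 t 0 x = zext (Top ord_max t) x by rewrite /T21 /= Top_t0 mulmx1.
have f12 x : T12 t (-1) x = 0 by rewrite /T12 /= mul0mx.
have f21 x : T21 t (-1) x = 0 by rewrite /T21 /= mulmx0.
have u0 G x y : umv 0 G x y = G (x + 1) y - G x (y + 1) :> 'M[B]_(#|tbasis N 2|).
  by rewrite /umv !scale0r subr0.
set K := kappa F N.
have g12 x : umv K (T12 t) (-1) x = zext (Top ord_max t) x.
  by rewrite /umv !f12 addNr e12 scaler0 !subr0.
have g21 x : umv K (T21 t) (-1) x = zext (Top ord_max t) x.
  by rewrite /umv !f21 addNr e21 scaler0 !subr0.
set Z := zext (Top ord_max t) (s%:Z + 1)%R.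
have k12 : umv K (T12 t) (-1 + 1) s = T1 *m T2 - Z - K%:A *: T2.
  by rewrite addNr /umv !e12.
have k21 : umv K (T21 t) (-1 + 1) s = T2 *m T1 - Z - K%:A *: T2.
  by rewrite addNr /umv !e21.
rewrite !u0 k12 k21 !g12 !g21 !f12 !f21 !addNr e12 e21 !subr0 -/Z /=.
exact: zmod_move.
Qed.

Lemma diag_comm (i k : 'I_N) (s : nat) : GRing.comm (t i i 1) (t k k s).
Proof.
set x := tpair i k.
have := congr1 (fun M : 'M[B]_(#|tbasis N 2|) => M x x) (comm_T1 s).
have mulE (M M' : 'M[B]_(#|tbasis N 2|)) :
  (M *m M') x x = \sum_c \sum_d M x (tpair c d) * M' (tpair c d) x.
  by rewrite mxE sum_pair.
have subE (M M' : 'M[B]_(#|tbasis N 2|)) : (M - M') x x = M x x - M' x x.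
  by rewrite !mxE.
rewrite /= !subE !mulE /x.
under eq_bigr do under eq_bigr do rewrite Top0_pair Top1_pair.
under [X in _ - X = _]eq_bigr do under eq_bigr do rewrite Top0_pair Top1_pair.
under [X in X - _ - _]eq_bigr do under eq_bigr do rewrite Pop_pair Top1_pair.
under [X in _ - X - _]eq_bigr do under eq_bigr do rewrite Pop_pair Top1_pair.
under [X in _ - (X - _)]eq_bigr do under eq_bigr do rewrite Qop_pair Top1_pair.
under [X in _ - (_ - X)]eq_bigr do under eq_bigr do rewrite Qop_pair Top1_pair.
have sum1 (f : 'I_N -> 'I_N -> B) c0 d0 :
    (forall c d, (c == c0) && (d == d0) = false -> f c d = 0) ->
  \sum_c \sum_d f c d = f c0 d0.
  move=> h; rewrite (bigD1 c0) //= [X in _ + X]big1 ?addr0 => [|c /negPf nc].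
    by rewrite (bigD1 d0) //= big1 ?addr0 // => d /negPf nd; apply: h; rewrite nd andbF.
  by apply: big1 => d _; apply: h; rewrite nc.
rewrite (sum1 _ i k) => [|c d]; last first.
  by rewrite [k == d]eq_sym; case: eqP; case: eqP; rewrite ?mulr0 ?mul0r.
rewrite (sum1 _ i k) => [|c d]; last first.
  by rewrite [i == c]eq_sym; case: eqP; case: eqP; rewrite ?mulr0 ?mul0r.
rewrite (sum1 _ i i) => [|c d]; last first.
  by rewrite [i == d]eq_sym; case: eqP; case: eqP; rewrite ?mulr0 ?mul0r.
rewrite (sum1 _ i i) => [|c d]; last first.
  by rewrite [i == c]eq_sym; case: eqP; case: eqP; rewrite ?andbF ?mulr0 ?mul0r.
rewrite (sum1 _ i (rev_ord i)) => [|c d]; last first.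
  by case: (c =P i) => [->|]; case: eqP; rewrite ?andbF ?mulr0 ?mul0r.
rewrite (sum1 _ i (rev_ord i)) => [|c d]; last first.
  by rewrite [i == c]eq_sym; case: (c =P i) => [->|]; case: eqP; rewrite ?mulr0 ?mul0r.
rewrite !eqxx !mulr1 !andbT /= => h; apply/eqP; rewrite -subr_eq0 h.
rewrite [k == i]eq_sym; case: (i =P k) => [->|_]; case: (k =P _) => [<-|_].
all: by rewrite ?mulr0 ?mul0r ?mulr1 ?mul1r !subrr.
Qed.

End Commutation.

Section AdjointInvariants.
Variables (F : fieldType) (B : algType F) (I : Type) (f : I -> B).

Definition ad_invariants : {pred B} :=
  fun y => `[< forall i, f i * y - y * f i = 0 >].

Lemma ad_invariants_subalg : subalg_closed ad_invariants.
Proof.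
split=> [|c x y|x y].
- by apply/asboolP=> i; rewrite mulr1 mul1r subrr.
- move=> /asboolP hx /asboolP hy; apply/asboolP=> i.
  have /eqP := hx i; have /eqP := hy i; rewrite !subr_eq0 => /eqP ey /eqP ex.
  by rewrite mulrDl mulrDr ey -scalerAl -scalerAr ex subrr.
- move=> /asboolP hx /asboolP hy; apply/asboolP=> i.
  have /eqP := hx i; have /eqP := hy i; rewrite !subr_eq0 => /eqP ey /eqP ex.
  by rewrite mulrA ex -!mulrA ey subrr.
Qed.

End AdjointInvariants.

Section Invariants.
Variables (F : fieldType) (N : nat).

Lemma half_leq : (N./2 <= N)%N.
Proof. by rewrite -{2}(odd_double_half N) -addnn addnA leq_addl. Qed.

Definition hindex (i : 'I_(N./2)) : 'I_N := widen_ord half_leq i.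

(* The invariants of h = span(F_{ii} | 1 <= i <= N/2): under the embedding
   F_{ij} |-> t_{ij}^{(1)}, F_{ii} acts as the commutator with t_{ii}^{(1)}. *)
Definition hinv : {pred yangian F N} :=
  ad_invariants (fun i : 'I_(N./2) => ygen F (hindex i) (hindex i) 1).

Lemma hinv_subalg : subalg_closed hinv.
Proof. exact: ad_invariants_subalg. Qed.
HB.instance Definition _ :=
  GRing.isSubalgClosed.Build F (yangian F N) hinv hinv_subalg.

Record hinvariant := HInvariant { hval : yangian F N; hvalP : hval \in hinv }.
HB.instance Definition _ := [isSub for hval].
HB.instance Definition _ := [Choice of hinvariant by <:].
HB.instance Definition _ :=
  [SubChoice_isSubAlgebra of hinvariant by <:].

Lemma hdiagP (i : 'I_N) (r : nat) : ygen F i i r \in hinv.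
Proof.
apply/asboolP=> k; apply/eqP; rewrite subr_eq0; apply/eqP.
exact: diag_comm (@ygen0 F N) (@ygen_rtt F N) _ _ _.
Qed.

Definition hdiag (i : 'I_N) (r : nat) : hinvariant := HInvariant (hdiagP i r).

End Invariants.

Section HarishChandra.
Variables (F : fieldType) (N : nat).

Inductive left_ideal (B : pzRingType) (G : B -> Prop) : B -> Prop :=
| LIgen x : G x -> left_ideal G x
| LI0 : left_ideal G 0
| LID x y : left_ideal G x -> left_ideal G y -> left_ideal G (x + y)
| LIM a x : left_ideal G x -> left_ideal G (a * x).

Definition upper_gen (y : yangian F N) : Prop :=
  exists (i j : 'I_N) (r : nat), (i < j)%N /\ y = ygen F i j r.+1.

(* The variable (i, r) is lambda_i^{(r+1)}. *)
Definition hcvars : choiceType := ('I_(N./2) * nat)%type.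
Definition hcpoly : comAlgType F := {malg F[{cmonom hcvars}]}.

(* The quotient map Y(o_N)^h -> Y(o_N)^h / (Y(o_N)^h :&: I), the quotient being
   identified with the polynomial algebra freely generated by the images of the
   t_{ii}^{(r)}, 1 <= i <= N/2. *)
Record is_harish_chandra (chi : {lrmorphism hinvariant F N -> hcpoly}) : Prop :=
  IsHarishChandra {
    hc_ker : forall y, chi y = 0 <-> left_ideal upper_gen (hval y);
    hc_gen : forall (i : 'I_(N./2)) (r : nat),
      chi (hdiag F (hindex i) r.+1) = << ucm ((i, r) : hcvars) >>
  }.

Definition lambda (chi : {lrmorphism hinvariant F N -> hcpoly}) (i : 'I_N) :
    nat -> hcpoly :=
  fun r => chi (hdiag F i r).

End HarishChandra.

Arguments hinv {F N}.

(* Main.v *)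
Require Import Defs.
From HB Require Import structures.
From mathcomp Require Import all_boot all_order all_algebra.
From mathcomp Require Import fingroup perm ring zify.
From mathcomp Require Import finmap boolp reals complex.
From mathcomp.multinomials Require Import monalg.

(** Write A for the product T_1(u) T_2(u+1) ... T_m(u+m-1) and index the basis
    tensors by functions y from the m copies to the N indices, so that the entry
    A(x, y) is the product over a of t_{x_a y_a}(u+a), the copies a being counted
    from 0.  A functional on tensors is called harmonic when it is symmetric and
    vanishes on every tensor sum_k (... e_k ... e_k' ...), that is, when it
    factors through the degree m part of the ring C[z_1, ..., z_N] / (q), where
    q = sum_k z_k z_k'.

    The rows of S are harmonic ([Ssym_harmonic]), and right multiplication by A
    preserves harmonic functionals ([row_legs_harmonic]): for neighbouring copies
    the parameters differ by one, and R(-1) = 1 + P - (2/N) Q is twice the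
    projection onto harmonic tensors in two copies, so that the RTT relation
    moves this projection to the other side of T_a T_{a+1}.  Hence the rows of
    S A are harmonic.

    For N = 2n the relation z_n z_n' = - sum_{k < n} z_k z_k' rewrites every
    monomial as a combination of the monomials which are not divisible by
    z_n z_n', and these form a basis of the quotient ring.  Let reduction z be
    the harmonic functional which reads off the coefficient of the basis monomial
    z.  A harmonic functional f is the sum of the f(z) reduction z
    ([harmonic_expand]), and S fixes harmonic functionals
    ([ract_Ssym_harmonic]); therefore
      tr S A = sum over basis monomials z and tensors y
               of reduction z (y) A(y, z)   ([trace_formula]),
    where z also denotes the tensor with the indices in increasing order.

    The term y = z gives the product of the lambda_{z_a}(u+a).  If y differs from
    z and reduction z (y) is nonzero, then y and z have the same weight and z
    arises from y by replacing pairs n, n' by pairs k, k' with k < n, up to the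
    order; this forces y_p < z_p at the last place p where they differ
    ([reduction_dominance]).  The product of the factors of A(y, z) up to the
    place p then has weight zero and lies in the left ideal I, so it is mapped to
    zero, while the remaining factors are diagonal and hence invariant.  As the
    Harish-Chandra map is multiplicative on the invariants, the whole term is
    mapped to zero ([hc_legs_offdiag]). *)

Set Implicit Arguments.
Unset Strict Implicit.
Unset Printing Implicit Defensive.

Import GRing.Theory.
Local Open Scope ring_scope.

(** * Formal series as an algebra *)

(** The ring structure turns iterated convolutions into products, so that the
    algebra of noncommutative rings applies to them. *)
Section SeriesRing.
Variable B : nzRingType.

Definition series : Type := nat -> B.
HB.instance Definition _ := gen_eqMixin series.
HB.instance Definition _ := gen_choiceMixin series.

Implicit Types f g h : series.

Definition series_add f g : series := fun r => f r + g r.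
Definition series_opp f : series := fun r => - f r.

Lemma series_addA : associative series_add.
Proof. by move=> f g h; apply/funext=> r; apply: addrA. Qed.
Lemma series_addC : commutative series_add.
Proof. by move=> f g; apply/funext=> r; apply: addrC. Qed.
Lemma series_add0 : left_id (fun=> 0 : B) series_add.
Proof. by move=> f; apply/funext=> r; apply: add0r. Qed.
Lemma series_addN : left_inverse (fun=> 0 : B) series_opp series_add.
Proof. by move=> f; apply/funext=> r; apply: addNr. Qed.
HB.instance Definition _ := GRing.isZmodule.Build series
  series_addA series_addC series_add0 series_addN.

Definition series_mul f g : series := sconv f g.

Lemma sconv_rev f g r : sconv f g r = \sum_(k < r.+1) f (r - k)%N * g k.
Proof.
rewrite /sconv (reindex_inj rev_ord_inj) /=; apply: eq_bigr => k _.
by rewrite !subSS subKn // -ltnS.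
Qed.

Lemma series_mulA : associative series_mul.
Proof.
move=> f g h; apply/funext=> r; rewrite /series_mul [RHS]sconv_rev.
pose G j i := f j * (g (r - i - j)%N * h i).
transitivity (\sum_(j < r.+1) \sum_(i < r.+1 | (i <= r - j)%N) G j i).
  apply: eq_bigr => j _; rewrite sconv_rev big_distrr /=.
  rewrite (big_ord_narrow_leq (leq_subr _ _)).
  by apply: eq_bigr => i _; rewrite /G /= -!subnDA addnC.
transitivity (\sum_(i < r.+1) \sum_(j < r.+1 | (j <= r - i)%N) G j i); last first.
  apply: eq_bigr => i _; rewrite big_distrl /=.
  rewrite (big_ord_narrow_leq (leq_subr _ _)).
  by apply: eq_bigr => j _; rewrite /G /= mulrA.
rewrite (exchange_big_dep predT) //=; apply: eq_bigr => i _.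
by apply: eq_bigl => j; rewrite -ltnS -[in RHS]ltnS -!subSn ?leq_ord // ltn_subCr.
Qed.

Lemma series_mul1 : left_id (@sone B) series_mul.
Proof.
move=> f; apply/funext=> r; rewrite /series_mul /sconv big_ord_recl big1.
  by rewrite /sone mul1r subn0 addr0.
by move=> i _; rewrite /sone mul0r.
Qed.

Lemma series_mulr1 : right_id (@sone B) series_mul.
Proof.
move=> f; apply/funext=> r; rewrite /series_mul sconv_rev big_ord_recl big1.
  by rewrite /sone mulr1 subn0 addr0.
by move=> i _; rewrite /sone mulr0.
Qed.

Lemma series_mulDl : left_distributive series_mul series_add.
Proof.
move=> f g h; apply/funext=> r; rewrite /series_mul /series_add /sconv -big_split.
by apply: eq_bigr => i _; rewrite mulrDl.
Qed.

Lemma series_mulDr : right_distributive series_mul series_add.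
Proof.
move=> f g h; apply/funext=> r; rewrite /series_mul /series_add /sconv -big_split.
by apply: eq_bigr => i _; rewrite mulrDr.
Qed.

Lemma sone_neq0 : (sone B : series) != 0.
Proof. by apply/eqP=> /(congr1 (@^~ 0%N)) /eqP; rewrite /sone oner_eq0. Qed.

HB.instance Definition _ := GRing.Zmodule_isNzRing.Build series
  series_mulA series_mul1 series_mulr1 series_mulDl series_mulDr sone_neq0.

Lemma seriesD f g r : (f + g) r = f r + g r. Proof. by []. Qed.
Lemma seriesB f g r : (f - g) r = f r - g r. Proof. by []. Qed.
Lemma series0 r : (0 : series) r = 0. Proof. by []. Qed.
Lemma seriesM f g r : (f * g) r = \sum_(k < r.+1) f k * g (r - k)%N.
Proof. by []. Qed.

Lemma series_sum I (s : seq I) (P : pred I) (F : I -> series) r :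
  (\sum_(i <- s | P i) F i) r = \sum_(i <- s | P i) F i r.
Proof. by elim/big_rec2: _ => // i x y _ <-. Qed.

End SeriesRing.

Section SeriesAlgebra.
Variables (F : fieldType) (B : algType F).
Implicit Types f g : series B.

Definition series_scale (c : F) f : series B := fun r => c *: f r.

Lemma series_scaleA a b f : series_scale a (series_scale b f) = series_scale (a * b) f.
Proof. by apply/funext=> r; apply: scalerA. Qed.
Lemma series_scale1 : left_id 1 series_scale.
Proof. by move=> f; apply/funext=> r; apply: scale1r. Qed.
Lemma series_scaleDr : right_distributive series_scale +%R.
Proof. by move=> c f g; apply/funext=> r; apply: scalerDr. Qed.
Lemma series_scaleDl f : {morph series_scale^~ f : a b / a + b}.
Proof. by move=> a b; apply/funext=> r; apply: scalerDl. Qed.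
HB.instance Definition _ := GRing.Zmodule_isLmodule.Build F (series B)
  series_scaleA series_scale1 series_scaleDr series_scaleDl.

Lemma series_scaleAl (c : F) f g : c *: (f * g) = (c *: f) * g.
Proof.
apply/funext=> r; rewrite [RHS]seriesM -[LHS]/(c *: sconv f g r) scaler_sumr.
by apply: eq_bigr => k _; rewrite scalerAl.
Qed.
HB.instance Definition _ :=
  GRing.Lmodule_isLalgebra.Build F (series B) series_scaleAl.
Lemma series_scaleAr (c : F) f g : c *: (f * g) = f * (c *: g).
Proof.
apply/funext=> r; rewrite [RHS]seriesM -[LHS]/(c *: sconv f g r) scaler_sumr.
by apply: eq_bigr => k _; rewrite -scalerAr.
Qed.
HB.instance Definition _ :=
  GRing.Lalgebra_isAlgebra.Build F (series B) series_scaleAr.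

Lemma seriesZ (c : F) f r : (c *: f) r = c *: f r. Proof. by []. Qed.

End SeriesAlgebra.

(** * Functionals on tensors and factors of the symmetrizer *)

Section Functionals.
Variables (N m : nat).
Local Notation idx := {ffun 'I_m -> 'I_N}.

Definition set_leg (y : idx) (a : 'I_m) (i : 'I_N) : idx :=
  [ffun c => if c == a then i else y c].

Definition swap_legs (a b : 'I_m) (y : idx) : idx := [ffun c => y (tperm a b c)].

Definition contraction (V : zmodType) (a b : 'I_m) (f : idx -> V) (y : idx) : V :=
  \sum_k f (set_leg (set_leg y b (rev_ord k)) a k).

(** [contraction a b f] is f applied to the invariant tensor sum_k e_k (x) e_k'
    placed in the copies a and b, so these are the functionals which R_{ab}(-1)
    doubles. *)
Definition harmonic (V : zmodType) (a b : 'I_m) (f : idx -> V) : Prop :=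
  (forall y, f (swap_legs a b y) = f y) /\ (forall y, contraction a b f y = 0).

Lemma swap_legsE a b y : swap_legs a b y = set_leg (set_leg y b (y a)) a (y b).
Proof.
apply/ffunP=> c; rewrite !ffunE.
by case: tpermP => [->|->|/eqP/negPf-> /eqP/negPf->]; rewrite ?eqxx //; case: eqP => [->|].
Qed.

Lemma set_legC y a b i j : a != b -> set_leg (set_leg y a i) b j = set_leg (set_leg y b
    j) a i.
Proof.
move=> ab; apply/ffunP=> c; rewrite !ffunE; case: eqP => // ->.
by rewrite eq_sym (negPf ab).
Qed.

Lemma set_legK y a i j : set_leg (set_leg y a i) a j = set_leg y a j.
Proof. by apply/ffunP=> c; rewrite !ffunE; case: eqP. Qed.

Lemma set_leg_id y a : set_leg y a (y a) = y.
Proof. by apply/ffunP=> c; rewrite !ffunE; case: eqP => [->|]. Qed.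

Lemma swap_legsK a b : involutive (swap_legs a b).
Proof. by move=> y; apply/ffunP=> c; rewrite !ffunE tpermK. Qed.

Lemma swap_set_leg2 a b y i j : a != b ->
  swap_legs a b (set_leg (set_leg y b j) a i) = set_leg (set_leg y b i) a j.
Proof.
move=> ab; apply/ffunP=> c; rewrite !ffunE.
by case: tpermP => [->|->|/eqP/negPf-> /eqP/negPf->]; rewrite ?eqxx // eq_sym (negPf ab).
Qed.

End Functionals.

Section RMatrix.
Variables (F : fieldType) (N m : nat).
Local Notation idx := {ffun 'I_m -> 'I_N}.

(** Row vectors are written as functions of the basis tensors; [ract] is right
    multiplication by a matrix.  Permuting or replacing indices is easier on
    functions than on matrix entries. *)
Definition ract (f : idx -> F) (M : 'M[F]_(#|tbasis N m|)) : idx -> F :=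
  fun y => \sum_x f (tindex x) * M x (enum_rank (y : tbasis N m)).

Lemma tindexK (y : idx) : tindex (enum_rank (y : tbasis N m)) = y.
Proof. exact: enum_rankK. Qed.

Lemma ract1 f : ract f 1 = f.
Proof.
apply/funext=> y; rewrite /ract (bigD1 (enum_rank (y : tbasis N m))) //= big1.
  by rewrite mxE eqxx mulr1 addr0 tindexK.
by move=> x /negPf nx; rewrite mxE nx mulr0.
Qed.

Lemma ract_mulmx f M M' : ract f (M *m M') = ract (ract f M) M'.
Proof.
apply/funext=> y; rewrite /ract.
under eq_bigr do rewrite mxE mulr_sumr.
rewrite exchange_big; apply: eq_bigr => z _; rewrite mulr_suml.
by apply: eq_bigr => x _; rewrite /tindex enum_valK mulrA.
Qed.

Lemma ractM f M M' : ract f (M * M') = ract (ract f M) M'.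
Proof. exact: ract_mulmx. Qed.

Lemma ractD f M M' y : ract f (M + M') y = ract f M y + ract f M' y.
Proof. by rewrite /ract -big_split; apply: eq_bigr => x _; rewrite mxE mulrDr. Qed.

Lemma ractZ f c M y : ract f (c *: M) y = c * ract f M y.
Proof. by rewrite /ract mulr_sumr; apply: eq_bigr => x _; rewrite mxE mulrCA. Qed.

Lemma ractN f M y : ract f (- M) y = - ract f M y.
Proof. by rewrite -scaleN1r ractZ mulN1r. Qed.

Lemma ract_sum f I (s : seq I) (P : pred I) (M : I -> 'M_(#|tbasis N m|)) y :
  ract f (\sum_(i <- s | P i) M i) y = \sum_(i <- s | P i) ract f (M i) y.
Proof.
elim/big_rec2: _ => [|i x M' _ <-]; last exact: ractD.
by rewrite /ract big1 // => x _; rewrite mxE mulr0.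
Qed.

Lemma ract_eop f a i j y :
  ract f (eop F a i j) y = (y a == j)%:R * f (set_leg y a i).
Proof.
rewrite /ract (bigD1 (enum_rank (set_leg y a i : tbasis N m))) //= big1 ?addr0.
  rewrite tindexK mxE !tindexK ffunE !eqxx mulrC; congr ((nat_of_bool _)%:R * _).
  rewrite (_ : [forall c, _]) ?andbT //; apply/forallP=> c.
  by apply/implyP=> /negPf ca; rewrite ffunE ca.
move=> x nx; rewrite mxE tindexK; case: and3P => [[/eqP e1 _ /forallP e2]|_].
  case/eqP: nx; apply: enum_val_inj; rewrite enum_rankK; apply/ffunP=> c.
  rewrite ffunE; case: eqP => [->//|/eqP ca].
  by move: (e2 c); rewrite ca => /eqP.
by rewrite mulr0.
Qed.

Lemma ract_Pop f a b y : a != b -> ract f (Pop N F a b) y = f (swap_legs a b y).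
Proof.
move=> ab; rewrite swap_legsE /Pop ract_sum (bigD1 (y b)) //= [X in _ + X]big1 ?addr0.
  rewrite ract_sum (bigD1 (y a)) //= [X in _ + X]big1 ?addr0.
    rewrite ract_mulmx !ract_eop eqxx mul1r ffunE (negPf ab) eqxx mul1r //.
  move=> j /negPf nj; rewrite ract_mulmx !ract_eop ffunE (negPf ab).
  by rewrite [y a == j]eq_sym nj mul0r mulr0.
move=> i /negPf ni; rewrite ract_sum big1 // => j _.
by rewrite ract_mulmx ract_eop [y b == i]eq_sym ni mul0r.
Qed.

Lemma ract_Qop f a b y : a != b ->
  ract f (Qop N F a b) y = (y a == rev_ord (y b))%:R * contraction a b f y.
Proof.
move=> ab; rewrite /Qop ract_sum /contraction mulr_sumr; apply: eq_bigr => i _.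
rewrite ract_sum (bigD1 (y a)) //= [X in _ + X]big1 ?addr0.
  rewrite ract_mulmx !ract_eop ffunE (negPf ab) eqxx mul1r.
  by rewrite [y b == _]eq_sym -(inj_eq rev_ord_inj) rev_ordK.
move=> j /negPf nj; rewrite ract_mulmx !ract_eop ffunE (negPf ab).
by rewrite [y a == j]eq_sym nj mul0r mulr0.
Qed.

(** The action of 1 + c P_{ab} - d Q_{ab} on row vectors. *)
Definition rfactor (c d : F) (a b : 'I_m) (f : idx -> F) : idx -> F := fun y =>
  f y + c * f (swap_legs a b y) - d * ((y a == rev_ord (y b))%:R * contraction a b f y).

Lemma ract_rfactor c d a b f : a != b ->
  ract f (1 + c *: Pop N F a b - d *: Qop N F a b) = rfactor c d a b f.
Proof.
move=> ab; apply/funext=> y.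
by rewrite !ractD ractN !ractZ ract1 ract_Pop // ract_Qop.
Qed.

Definition set_leg3 (p q b : 'I_m) (y : idx) i j k : idx := set_leg (set_leg (set_leg y
    b k) q j) p i.

(** Factors in copies other than p and q commute with P_{pq} and Q_{pq}. *)
Lemma rfactor_disjoint_harmonic p q a b c d f : p != q -> a != b ->
  [&& p != a, p != b, q != a & q != b] ->
  harmonic p q f -> harmonic p q (rfactor c d a b f).
Proof.
move=> pq ab /and4P[pa pb qa qb] [fS fC].
have swpu y e l : e != p -> e != q -> swap_legs p q (set_leg y e l) = set_leg
    (swap_legs p q y) e l.
  rewrite ![e == _]eq_sym => /negPf ep /negPf eq; apply/ffunP=> z; rewrite !ffunE.
  by case: tpermP => [->|->|//]; rewrite ep eq.
have swps y : swap_legs p q (swap_legs a b y) = swap_legs a b (swap_legs p q y).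
  by rewrite !(swap_legsE a b) !swpu 1?eq_sym // !ffunE !tpermD // 1?eq_sym.
have swpv y e : e != p -> e != q -> swap_legs p q y e = y e.
  by move=> ep eq; rewrite ffunE tpermD // eq_sym.
split=> y.
  rewrite /rfactor fS -swps fS !swpv 1?eq_sym //; congr (_ - _ * (_ * _)).
  rewrite /contraction; apply: eq_bigr => k _.
  by rewrite -(fS (set_leg _ _ _)) !swpu 1?eq_sym // swap_legsK.
rewrite /contraction /rfactor sumrB big_split /= -!mulr_sumr.
have -> : \sum_i f (set_leg (set_leg y q (rev_ord i)) p i) = 0 := fC y.
have -> : \sum_i f (swap_legs a b (set_leg (set_leg y q (rev_ord i)) p i)) = 0.
  rewrite -[RHS](fC (swap_legs a b y)); apply: eq_bigr => i _.
  have H e l z : e != a -> e != b -> swap_legs a b (set_leg z e l) = set_leg (swap_legs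
      a b z) e l.
    move=> ea eb; rewrite !swap_legsE !ffunE ![_ == e]eq_sym (negPf ea) (negPf eb).
    by rewrite (@set_legC _ _ _ e) // (@set_legC _ _ _ e).
  by rewrite !H // eq_sym.
rewrite (eq_bigr (fun i => (y a == rev_ord (y b))%:R
   * contraction a b f (set_leg (set_leg y q (rev_ord i)) p i))); last first.
  by move=> i _; rewrite !ffunE ![_ == p]eq_sym ![_ == q]eq_sym
     (negPf pa) (negPf pb) (negPf qa) (negPf qb).
rewrite -mulr_sumr /contraction exchange_big big1 ?mulr0 ?subr0 ?addr0 // => k _.
rewrite -[RHS](fC (set_leg (set_leg y b (rev_ord k)) a k)); apply: eq_bigr => i _.
by rewrite !(@set_legC _ _ _ p) // (@set_legC _ _ _ q b) // (@set_legC _ _ _ q a).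
Qed.

(** This is what replaces the Yang-Baxter equation: a row vector f = f R_{pq}(-1) / 2
    multiplied by R_{pb} R_{qb} is again of this form.  With phi(i, j, k) the value
    of f when p, q, b carry i, j, k, and psi(j) = sum_l phi(l, j, l'), all nine
    terms of the product reduce by symmetry and tracelessness to values of phi and
    psi ([gE] in the proof).  The first two relations between the coefficients make
    the result symmetric; the third one makes it traceless. *)
Lemma rfactor2_harmonic p q b (c c' d d' : F) f : p != q -> p != b -> q != b ->
  c * c' = c' - c -> d * d' = d' - d -> 2 * c' = 2 * d + N%:R * d * c' ->
  harmonic p q f -> harmonic p q (rfactor c' d' q b (rfactor c d p b f)).
Proof.
move=> pq pb qb ec ed etr [fS fC].
pose u y i j k := set_leg3 p q b y i j k.
have up y i j k : u y i j k p = i by rewrite !ffunE eqxx.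
have uq y i j k : u y i j k q = j by rewrite !ffunE eqxx eq_sym (negPf pq).
have ub y i j k : u y i j k b = k.
  by rewrite !ffunE eqxx ![b == _]eq_sym (negPf pb) (negPf qb).
have upp y i j k i' : set_leg (u y i j k) p i' = u y i' j k by rewrite /u /set_leg3
    set_legK.
have uqq y i j k i' : set_leg (u y i j k) q i' = u y i i' k.
  by rewrite /u /set_leg3 (set_legC _ _ _ pq) set_legK.
have ubb y i j k i' : set_leg (u y i j k) b i' = u y i j i'.
  by rewrite /u /set_leg3 (set_legC _ _ _ pb) (set_legC _ _ _ qb) set_legK.
have uS y i j k : f (u y i j k) = f (u y j i k).
  by rewrite -[in LHS]fS swap_legsE up uq uqq upp.
have uC y k : \sum_i f (u y i (rev_ord i) k) = 0.
  exact: (fC (set_leg y b k)).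
pose psi y j := \sum_l f (u y l j (rev_ord l)).
have psi1 y j : \sum_l f (u y j l (rev_ord l)) = psi y j.
  by apply: eq_bigr => l _; rewrite uS.
have psi2 y j : \sum_l f (u y (rev_ord l) j l) = psi y j.
  by rewrite (reindex_inj rev_ord_inj); apply: eq_bigr => l _; rewrite rev_ordK.
set g := rfactor c' d' q b _.
have gE y i j k : g (u y i j k) =
  f (u y i j k) + c * f (u y k j i) + c' * f (u y i k j) + c * c' * f (u y j k i)
   - d * ((i == rev_ord k)%:R * psi y j + (j == rev_ord k)%:R * psi y i)
   - d * c' * ((i == rev_ord j)%:R * psi y k).
  have r1E i1 j1 k1 : rfactor c d p b f (u y i1 j1 k1) = f (u y i1 j1 k1)
      + c * f (u y k1 j1 i1) - d * ((i1 == rev_ord k1)%:R * psi y j1).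
    rewrite /rfactor swap_legsE up ub ubb upp; congr (_ - _ * (_ * _)).
    by rewrite /contraction /psi; apply: eq_bigr => l _; rewrite ubb upp.
  rewrite /g {1}/rfactor swap_legsE uq ub ubb uqq !r1E.
  have -> : contraction q b (rfactor c d p b f) (u y i j k) = psi y i - d * psi y i.
    rewrite /contraction.
    under eq_bigr do rewrite ubb uqq r1E rev_ordK.
    rewrite sumrB big_split /= -!mulr_sumr psi1.
    under [X in c * X]eq_bigr do rewrite uS.
    rewrite uC mulr0 addr0; congr (_ - _ * _).
    rewrite (bigD1 i) //= big1 ?eqxx ?mul1r ?addr0 // => l /negPf nl.
    by rewrite eq_sym nl mul0r.
  have -> : d' * ((j == rev_ord k)%:R * (psi y i - d * psi y i))
          = d * ((j == rev_ord k)%:R * psi y i).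
    by rewrite mulrCA -[in RHS]mulrCA; congr (_ * _); ring: ed.
  ring.
(* By [ec] the coefficients of phi(k, j, i), phi(k, i, j) and of the two cyclic
   terms match. *)
have symg y i j k : g (swap_legs p q (u y i j k)) = g (u y i j k).
  rewrite swap_legsE up uq uqq upp !gE (uS y j i) (uS y k i) (uS y j k) (uS y k j) (uS
      y i k).
  have -> : (j == rev_ord i) = (i == rev_ord j).
    by rewrite -(inj_eq rev_ord_inj) rev_ordK eq_sym.
  ring: ec.
have trg y k : \sum_i g (u y i (rev_ord i) k) = 0.
  under eq_bigr do rewrite gE rev_ordK eqxx mul1r.
  rewrite !(sumrB, big_split) /= -!mulr_sumr uC add0r psi2 -/(psi y k) big_split /=.
  under eq_bigr do rewrite uS; rewrite psi2.
  have -> : \sum_i (i == rev_ord k)%:R * psi y (rev_ord i) = psi y k.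
    rewrite (bigD1 (rev_ord k)) //= eqxx mul1r big1 ?addr0 ?rev_ordK //.
    by move=> i /negPf ni; rewrite ni mul0r.
  have -> : \sum_i (rev_ord i == rev_ord k)%:R * psi y i = psi y k.
    rewrite (bigD1 k) //= eqxx mul1r big1 ?addr0 // => i /negPf ni.
    by rewrite (inj_eq rev_ord_inj) ni mul0r.
  rewrite sumr_const card_ord.
  transitivity ((2 * c' - 2 * d - N%:R * d * c') * psi y k); first by ring: ec.
  by rewrite etr; ring.
have yE y : y = u y (y p) (y q) (y b) by rewrite /u /set_leg3 !set_leg_id.
split=> y; first by rewrite (yE y) symg.
rewrite /contraction -[RHS](trg y (y b)).
by apply: eq_bigr => i _; rewrite [in LHS](yE y) uqq upp.
Qed.

End RMatrix.

(** * The rows of the symmetrizer are harmonic *)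

Section Harm.
Variables (F : fieldType) (N m : nat).
Local Notation idx := {ffun 'I_m -> 'I_N}.
Implicit Types f : idx -> F.

(** For d = 2/N the factor is R(-1), and R(-1) P = R(-1), R(-1) Q = 0. *)
Lemma rfactor1_harmonic p q (d : F) f : p != q -> N%:R * d = 2 ->
  harmonic p q (rfactor 1 d p q f).
Proof.
move=> pq Nd.
have cu y i j : contraction p q f (set_leg (set_leg y q j) p i) = contraction p q f y.
  by rewrite /contraction; apply: eq_bigr => k _; rewrite (set_legC _ _ _ pq) !set_legK.
split=> y.
  have -> : rfactor 1 d p q f (swap_legs p q y) = f (swap_legs p q y) + f y
      - d * ((y q == rev_ord (y p))%:R * contraction p q f y).
    by rewrite /rfactor swap_legsK mul1r swap_legsE cu !ffunE !eqxx [q == p]eq_sym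
        (negPf pq).
  rewrite /rfactor mul1r; congr (_ - _ * (_ * _)); first exact: addrC.
  by rewrite -[in LHS](inj_eq rev_ord_inj) rev_ordK eq_sym.
rewrite /contraction /rfactor; under eq_bigr do rewrite cu.
rewrite sumrB big_split /= -!mulr_sumr -/(contraction p q f y).
rewrite (_ : \sum_i f (swap_legs _ _ _) = contraction p q f y); last first.
  rewrite /contraction (reindex_inj rev_ord_inj); apply: eq_bigr => k _.
  by rewrite swap_set_leg2 // rev_ordK.
rewrite (eq_bigr (fun=> contraction p q f y)); last first.
  move=> k _; rewrite !ffunE !eqxx [q == p]eq_sym (negPf pq) rev_ordK eqxx.
  exact: mul1r.
by rewrite sumr_const card_ord; ring: Nd.
Qed.

Lemma rfactorC (a b a' b' : 'I_m) (c d c' d' : F) f :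
  a != b -> a' != b' -> [&& a != a', a != b', b != a' & b != b'] ->
  rfactor c d a b (rfactor c' d' a' b' f) = rfactor c' d' a' b' (rfactor c d a b f).
Proof.
move=> ab ab' /and4P[n1 n2 n3 n4].
have sv e x y z : e != x -> e != y -> swap_legs x y z e = z e.
  by move=> ex ey; rewrite ffunE tpermD // eq_sym.
have uv e x y i j z : e != x -> e != y -> set_leg (set_leg z y j) x i e = z e.
  by rewrite !ffunE => /negPf -> /negPf ->.
have uu x y i j x' y' i' j' z : [&& x != x', x != y', y != x' & y != y'] ->
    set_leg (set_leg (set_leg (set_leg z y j) x i) y' j') x' i' =
    set_leg (set_leg (set_leg (set_leg z y' j') x' i') y j) x i.
  case/and4P=> h1 h2 h3 h4.
  by rewrite !(@set_legC _ _ _ x) // (@set_legC _ _ _ y y') // (@set_legC _ _ _ y x').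
have su x y i j x' y' z : [&& x != x', x != y', y != x' & y != y'] ->
    swap_legs x' y' (set_leg (set_leg z y j) x i) = set_leg (set_leg (swap_legs x' y'
        z) y j) x i.
  move=> h; rewrite !swap_legsE uu //; case/and4P: h => h1 h2 h3 h4.
  by rewrite !uv // eq_sym.
have h : [&& a != a', a != b', b != a' & b != b'] by rewrite n1 n2 n3 n4.
have h' : [&& a' != a, a' != b, b' != a & b' != b].
  by rewrite ![a' == _]eq_sym ![b' == _]eq_sym n1 n2 n3 n4.
have cr : forall (a1 b1 a2 b2 : 'I_m) (e1 e2 : F) (z : idx), a1 != b1 -> a2 != b2 ->
    [&& a1 != a2, a1 != b2, b1 != a2 & b1 != b2] ->
    contraction a1 b1 (rfactor e1 e2 a2 b2 f) z = contraction a1 b1 f z + e1 *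
        contraction a1 b1 f (swap_legs a2 b2 z)
     - e2 * ((z a2 == rev_ord (z b2))%:R *
        \sum_k \sum_l f (set_leg (set_leg (set_leg (set_leg z b1 (rev_ord k)) a1 k) b2
            (rev_ord l)) a2 l)).
  move=> a1 b1 a2 b2 e1 e2 z xy xy' hh; rewrite /contraction /rfactor sumrB big_split
      /= -!mulr_sumr.
  congr (_ + _ * _ - _ * _).
    by apply: eq_bigr => k _; rewrite su.
  rewrite mulr_sumr; apply: eq_bigr => k _.
  by case/and4P: hh => h1 h2 h3 h4; rewrite !uv // eq_sym.
apply/funext=> z.
have rE a1 b1 e1 e2 (g : idx -> F) z1 : rfactor e1 e2 a1 b1 g z1 =
  g z1 + e1 * g (swap_legs a1 b1 z1)
   - e2 * ((z1 a1 == rev_ord (z1 b1))%:R * contraction a1 b1 g z1) by [].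
rewrite (rE a b) (rE a' b' c' d' (rfactor _ _ _ _ _)) !cr // !rE.
have -> : swap_legs a b (swap_legs a' b' z) = swap_legs a' b' (swap_legs a b z).
  by rewrite (swap_legsE a b (swap_legs _ _ _)) !sv // -su // -swap_legsE.
have -> : \sum_k \sum_l f (set_leg (set_leg (set_leg (set_leg z b' (rev_ord k)) a' k) b
    (rev_ord l)) a l)
  = \sum_k \sum_l f (set_leg (set_leg (set_leg (set_leg z b (rev_ord k)) a k) b'
      (rev_ord l)) a' l).
  by rewrite exchange_big; apply: eq_bigr => k _; apply: eq_bigr => l _; rewrite uu.
rewrite !sv //; first by ring.
all: by rewrite eq_sym.
Qed.

Hypotheses (F0 : [pchar F] =i pred0) (N_gt0 : (0 < N)%N).

(** The factor of the symmetrizer in the copies a < b, and below the product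
    [srow a] of the factors with a fixed, in lexicographic order. *)
Definition sfactor (a b : 'I_m) : (idx -> F) -> idx -> F :=
  rfactor (b - a)%N%:R^-1 (N%:R / 2 + (b - a)%N%:R - 1)^-1 a b.

Lemma ract_prod f I (s : seq I) (P : pred I) (M : I -> 'M[F]_(#|tbasis N m|)) :
  ract f (\prod_(i <- s | P i) M i) =
  foldl (fun g i => ract g (M i)) f [seq i <- s | P i].
Proof.
rewrite -big_filter; elim: [seq i <- s | P i] f => [|i s' IH] f.
  by rewrite big_nil ract1.
by rewrite big_cons ractM IH.
Qed.

Lemma enum_take_lt k (x : 'I_m) : x \in take k (enum 'I_m) -> (x < k)%N.
Proof.
move=> /(map_f val); rewrite map_take val_enum_ord take_iota mem_iota add0n.
by rewrite leq0n /= => h; apply: leq_trans h (geq_minl _ _).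
Qed.

Lemma enum_drop_ge k (x : 'I_m) : x \in drop k (enum 'I_m) -> (k <= x)%N.
Proof.
move=> /(map_f val); rewrite map_drop val_enum_ord drop_iota mem_iota add0n.
by case/andP.
Qed.

Lemma enum_filter_lt (a : 'I_m) :
  [seq b : 'I_m <- index_enum 'I_m | (a < b)%N] = drop a.+1 (enum 'I_m).
Proof.
rewrite -[index_enum _]enumT -[enum _ in LHS](cat_take_drop a.+1) filter_cat.
rewrite (_ : filter _ (take _ _) = [::]) ?cat0s.
  by apply/all_filterP/allP=> b /enum_drop_ge.
apply/eqP; rewrite -size_eq0 size_filter -leqn0 leqNgt -has_count.
by apply/hasPn=> b /enum_take_lt; rewrite ltnS leqNgt.
Qed.

Lemma drop_enum (a : 'I_m) : drop a (enum 'I_m) = a :: drop a.+1 (enum 'I_m).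
Proof. by rewrite (drop_nth a) ?size_enum_ord // nth_ord_enum. Qed.

Definition srow (a : 'I_m) f : idx -> F :=
  foldl (fun g b => sfactor a b g) f (drop a.+1 (enum 'I_m)).

Lemma ract_Ssym f :
  ract f (Ssym N m F) =
  fun y => (m`!%:R)^-1 * foldl (fun g a => srow a g) f (enum 'I_m) y.
Proof.
have srowE (g : idx -> F) (a : 'I_m) : ract g (\prod_(b < m | (a < b)%N)
    (1 + (b - a)%N%:R^-1 *: Pop N F a b
       - (N%:R / 2 + (b - a)%N%:R - 1)^-1 *: Qop N F a b)) = srow a g.
  rewrite /srow ract_prod enum_filter_lt.
  have: all (fun b : 'I_m => a < b)%N (drop a.+1 (enum 'I_m)).
    by apply/allP=> b /enum_drop_ge.
  elim: (drop _ _) g => //= b s' IH' g /andP[ab /IH' <-].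
  by rewrite ract_rfactor // neq_ltn ab.
have eG := funext (fun g => funext (srowE g)).
by apply/funext=> y; rewrite ractZ ract_prod eG filter_predT -[index_enum _]enumT.
Qed.

Lemma natr_gt0_neq0 k : (0 < k)%N -> k%:R != 0 :> F.
Proof. by rewrite (proj1 (pcharf0P _) F0) -lt0n. Qed.

(** With x = b - q the coefficients are c = 1/(x+1), c' = 1/x and
    d = 1/(N/2 + x), d' = 1/(N/2 + x - 1), for which the three relations of
    [rfactor2_harmonic] hold. *)
Lemma sfactor2_harmonic (p q b : 'I_m) f : q = p.+1 :> nat -> (q < b)%N ->
  harmonic p q f -> harmonic p q (sfactor q b (sfactor p b f)).
Proof.
move=> qp qb; have pq : (p < q)%N by rewrite qp.
have pb := ltn_trans pq qb.
apply: rfactor2_harmonic; rewrite ?neq_ltn ?pq ?pb ?qb //.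
all: have [k bk] : exists k, b = (q + k.+1)%N :> nat
  by exists (b - q.+1)%N; rewrite addnS -addSn subnKC.
all: have -> : (b - q)%N = k.+1 by rewrite bk addKn.
all: have -> : (b - p)%N = k.+2 by rewrite bk qp addSn -addnS addKn.
all: have h2 := natr_gt0_neq0 (isT : 0 < 2)%N; have h3 := natr_gt0_neq0 (isT : 0 < k.+1)%N.
all: have h4 := natr_gt0_neq0 (isT : 0 < k.+2)%N.
all: have k1 : k.+1%:R = k%:R + 1 :> F by rewrite natr1.
all: have k2 : k.+2%:R = k%:R + 2 :> F by rewrite -addn2 natrD.
all: rewrite ?k1 ?k2 in h3 h4 *.
- by field; apply/andP.
all: have h5 : N%:R + 2 * k%:R != 0 :> F.
1,3: by rewrite -natrM -natrD natr_gt0_neq0 // addn_gt0 N_gt0.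
all: have h6 : N%:R + 2 * (k%:R + 1) != 0 :> F.
1,3: by rewrite natr1 -natrM -natrD natr_gt0_neq0 // addn_gt0 N_gt0.
all: have -> : N%:R / 2 + (k%:R + 2) - 1 = (N%:R + 2 * (k%:R + 1)) / 2 :> F
  by field.
- have -> : N%:R / 2 + (k%:R + 1) - 1 = (N%:R + 2 * k%:R) / 2 :> F by field.
  by field; apply/and3P.
by field; apply/and3P.
Qed.

Lemma foldl_sfactorC (p q b : 'I_m) (s : seq 'I_m) f : q = p.+1 :> nat ->
  (q < b)%N -> all (fun c : 'I_m => b < c)%N s ->
  sfactor q b (foldl (fun g c => sfactor p c g) f s) = foldl (fun g c => sfactor p c g)
      (sfactor q b f) s.
Proof.
move=> qp qb; elim: s f => //= c s IH f /andP[bc sc].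
have pq : (p < q)%N by rewrite qp.
have qc := ltn_trans qb bc; have pc := ltn_trans pq qc; have pb := ltn_trans pq qb.
rewrite IH //; congr (foldl _ _ _); apply: rfactorC; rewrite ?neq_ltn ?qb ?pc //.
by rewrite pq qc pb bc !orbT.
Qed.

(** As R_{qb} commutes with R_{pc} for c > b, the two rows interleave to a product
    of the R_{pb} R_{qb}, each of which preserves harmonicity. *)
Lemma srow2_harmonic (p q : 'I_m) (s : seq 'I_m) f : q = p.+1 :> nat ->
  pairwise (fun b c : 'I_m => b < c)%N (q :: s) -> harmonic p q f ->
  harmonic p q (foldl (fun g b => sfactor q b g) (foldl (fun g b => sfactor p b g) f s) s).
Proof.
move=> qp; elim: s f => //= b s IH f /andP[/andP[qb qs] /andP[bs ss]] hf.
rewrite foldl_sfactorC //; apply: IH; first by rewrite qs ss.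
exact: sfactor2_harmonic.
Qed.

Lemma pairwise_enum k : pairwise (fun b c : 'I_m => b < c)%N (drop k (enum 'I_m)).
Proof.
rewrite -(pairwise_map val ltn) map_drop val_enum_ord drop_iota.
by rewrite -sorted_pairwise ?iota_ltn_sorted //; apply: ltn_trans.
Qed.

(** In S = ... (R_{pq} prod_b R_{pb}) (prod_b R_{qb}) ... the factor R_{pq}(-1)
    makes any row vector harmonic in p, q, the rest of the rows p and q preserves
    this, and the later rows do not involve the copies p and q. *)
Lemma Ssym_harmonic (p q : 'I_m) f : q = p.+1 :> nat ->
  harmonic p q (ract f (Ssym N m F)).
Proof.
move=> qp; rewrite ract_Ssym; have pq : (p < q)%N by rewrite qp.
have pq' : p != q by rewrite neq_ltn pq.
suff [hS hC] : harmonic p q (foldl (fun g a => srow a g) f (enum 'I_m)).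
  split=> y; first by rewrite hS.
  by rewrite /contraction -mulr_sumr -[X in _ * X]/(contraction p q _ y) hC mulr0.
have dq : drop p.+1 (enum 'I_m) = q :: drop q.+1 (enum 'I_m) by rewrite -qp drop_enum.
rewrite -(cat_take_drop p (enum 'I_m)) foldl_cat drop_enum dq /=.
set g := foldl _ f _.
have: harmonic p q (srow q (srow p g)).
  rewrite /srow dq /=; apply: srow2_harmonic => //.
    by rewrite -drop_enum pairwise_enum.
  rewrite /sfactor qp subSnn invr1; apply: rfactor1_harmonic => //.
  rewrite addrK invf_div mulrC divfK // natr_gt0_neq0 //.
have : all (fun b : 'I_m => q < b)%N (drop q.+1 (enum 'I_m)).
  by apply/allP=> b /enum_drop_ge.
elim: (drop _ _) (srow q _) => //= a s IH h /andP[qa /IH {}IH] hh; apply: IH.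
have : all (fun b : 'I_m => a < b)%N (drop a.+1 (enum 'I_m)).
  by apply/allP=> b /enum_drop_ge.
rewrite /srow; elim: (drop _ _) h hh => //= b s' IH h hh /andP[ab /IH {}IH]; apply: IH.
have pa := ltn_trans pq qa; have qb := ltn_trans qa ab; have pb := ltn_trans pq qb.
by apply: rfactor_disjoint_harmonic => //; rewrite ?neq_ltn ?pa ?qa ?qb ?pb ?ab.
Qed.

End Harm.

(** * Substituting shifted parameters into double series *)

Section Shift.
Variables (F : fieldType) (V : lmodType F).
Implicit Types f g : nat -> V.

(** Multiplication by u^{-1}. *)
Definition delay (W : zmodType) (f : nat -> W) : nat -> W :=
  fun r => if r is k.+1 then f k else 0.

Lemma sshift_delay0 (c : F) f : sshift c (delay f) 0 = 0.
Proof. by rewrite /sshift big_ord1 scaler0. Qed.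

(** The substitution sends multiplication by u^{-1} to multiplication by
    (u+c)^{-1}: multiplying the image of u^{-1} f by u + c gives the image of f.
    On coefficients this is the Pascal rule. *)
Lemma sshift_delayS (c : F) f k :
  sshift c (delay f) k.+1 + c *: sshift c (delay f) k = sshift c f k.
Proof.
rewrite /sshift big_ord_recl scaler0 add0r.
under eq_bigr do rewrite lift0 subSS /=.
case: k => [|k]; first by rewrite !big_ord1 !scaler0 addr0.
rewrite [X in _ + _ *: X]big_ord_recl scaler0 add0r.
under [X in _ + _ *: X]eq_bigr do rewrite lift0 subSS /=.
rewrite big_ord_recr [RHS]big_ord_recr /= !subnn !bin0 addrAC; congr (_ + _).
rewrite scaler_sumr -big_split; apply: eq_bigr => s _ /=.
rewrite scalerA -scalerDl subSn ?leq_ord // binS natrD exprS; congr (_ *: _).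
by ring.
Qed.

Lemma sshiftB (c : F) f g k :
  sshift c (fun r => f r - g r) k = sshift c f k - sshift c g k.
Proof. by rewrite /sshift -sumrB; apply: eq_bigr => s _; rewrite scalerBr. Qed.

Lemma sshiftZ (c e : F) f k : sshift c (fun r => e *: f r) k = e *: sshift c f k.
Proof.
by rewrite /sshift scaler_sumr; apply: eq_bigr => s _; rewrite !scalerA mulrC.
Qed.

Lemma sshift0 (c : F) k : sshift c (fun=> 0 : V) k = 0.
Proof. by rewrite /sshift big1 // => s _; rewrite scaler0. Qed.

End Shift.

Section Evaluation.
Variables (F : fieldType) (B : algType F) (a b : F).
Implicit Types G H : series (series B).

(** A double series G = sum_{r,s} G_{r,s} u^{-r} v^{-s} is a series with series
    coefficients; its value at the parameters u+a and u+b is a series in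
    u^{-1}. *)
Definition eval_at G : series B := fun k =>
  \sum_(i < k.+1) sshift a (fun r => sshift b (G r) (k - i)%N) i.

Definition delay1 G : series (series B) := delay G.
Definition delay2 G : series (series B) := fun r => delay (G r).

Lemma delay1B : zmod_morphism delay1.
Proof. by move=> G H; apply/funext=> [[|r]] //=; rewrite seriesB subrr. Qed.
HB.instance Definition _ :=
  GRing.isZmodMorphism.Build (series (series B)) (series (series B)) delay1 delay1B.
Lemma delay1Z : scalable delay1.
Proof. by move=> c G; apply/funext=> [[|r]] //=; rewrite seriesZ scaler0. Qed.
HB.instance Definition _ :=
  GRing.isScalable.Build F (series (series B)) (series (series B)) *:%R delay1 delay1Z.

Lemma delay2B : zmod_morphism delay2.
Proof.
move=> G H; apply/funext=> r; apply/funext=> [[|s]] //.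
by rewrite !seriesB subrr.
Qed.
HB.instance Definition _ :=
  GRing.isZmodMorphism.Build (series (series B)) (series (series B)) delay2 delay2B.
Lemma delay2Z : scalable delay2.
Proof.
move=> c G; apply/funext=> r; apply/funext=> [[|s]] //.
by rewrite !seriesZ scaler0.
Qed.
HB.instance Definition _ :=
  GRing.isScalable.Build F (series (series B)) (series (series B)) *:%R delay2 delay2Z.

Lemma delay12 G : delay1 (delay2 G) = delay2 (delay1 G).
Proof. by apply/funext=> [[|r]]; apply/funext=> [[|s]]. Qed.

Lemma eval_atB : zmod_morphism eval_at.
Proof.
move=> G H; apply/funext=> k; rewrite seriesB /eval_at -sumrB; apply: eq_bigr => i _.
by rewrite -sshiftB; congr (sshift _ _ _); apply/funext=> r; rewrite -sshiftB.
Qed.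
HB.instance Definition _ :=
  GRing.isZmodMorphism.Build (series (series B)) (series B) eval_at eval_atB.

Lemma eval_atZ : scalable eval_at.
Proof.
move=> c G; apply/funext=> k; rewrite seriesZ /eval_at scaler_sumr.
apply: eq_bigr => i _; rewrite -sshiftZ; congr (sshift _ _ _).
by apply/funext=> r; rewrite -sshiftZ.
Qed.
HB.instance Definition _ :=
  GRing.isScalable.Build F (series (series B)) (series B) *:%R eval_at eval_atZ.

Lemma eval_at_delay1S G k : eval_at (delay1 G) k.+1 + a *: eval_at (delay1 G) k =
    eval_at G k.
Proof.
have E j : (fun r => sshift b (delay1 G r) j) = delay (fun r => sshift b (G r) j).
  by apply/funext=> [[|r]] //=; apply: sshift0.
rewrite /eval_at big_ord_recl E sshift_delay0 add0r scaler_sumr -big_split.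
by apply: eq_bigr => i _; rewrite lift0 subSS /= !E sshift_delayS.
Qed.

Lemma eval_at_delay2S G k : eval_at (delay2 G) k.+1 + b *: eval_at (delay2 G) k =
    eval_at G k.
Proof.
rewrite /eval_at big_ord_recr /= subnn.
rewrite [X in _ + X + _](_ : _ = 0) ?addr0; last first.
  rewrite -[RHS](@sshift0 F B a k.+1); congr (sshift _ _ _).
  by apply/funext=> r; apply: sshift_delay0.
rewrite scaler_sumr -big_split; apply: eq_bigr => i _ /=.
rewrite subSn ?leq_ord // -sshiftZ /sshift -big_split; apply: eq_bigr => s _ /=.
by rewrite -scalerDr -/(sshift _ _ _) sshift_delayS.
Qed.

(** The inverse of u+a is not a zero divisor, so evaluated identities may be
    divided by it. *)
Lemma eval_at_delay1_inj G : eval_at (delay1 G) = 0 -> eval_at G = 0.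
Proof. by move=> h; apply/funext=> k; rewrite -eval_at_delay1S h !series0 scaler0
    addr0. Qed.

Lemma eval_at_delay2_inj G : eval_at (delay2 G) = 0 -> eval_at G = 0.
Proof. by move=> h; apply/funext=> k; rewrite -eval_at_delay2S h !series0 scaler0
    addr0. Qed.

(** Multiplication by (u - v - c) u^{-1} v^{-1}, which keeps the exponents
    nonnegative. *)
Definition uminusv (c : F) G : series (series B) :=
  delay2 G - delay1 G - c *: delay1 (delay2 G).

Lemma uminusv_delay c G :
  delay1 (delay2 (uminusv c G)) = uminusv c (delay1 (delay2 G)).
Proof. by rewrite /uminusv !linearB !linearZ /= !delay12. Qed.

(** At the parameters u+a and u+b the factor u - v - c becomes the scalar
    a - b - c. *)
Lemma eval_at_uminusv c G : eval_at (uminusv c G) = (a - b - c) *: eval_at (delay1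
    (delay2 G)).
Proof.
rewrite /uminusv raddfB raddfB /= linearZ /= [in RHS]scalerBl; congr (_ - _).
apply/funext=> k; rewrite seriesB seriesZ -(eval_at_delay1S (delay2 G)).
by rewrite -(eval_at_delay2S (delay1 G)) -delay12 opprD addrACA subrr add0r scalerBl.
Qed.

Lemma eval_at_mul (f g : series B) :
  eval_at (fun r s => f r * g s) = (sshift a f : series B) * (sshift b g : series B).
Proof.
apply/funext=> k; rewrite seriesM; apply: eq_bigr => i _.
rewrite {1}/sshift /sshift mulr_suml; apply: eq_bigr => r _.
rewrite -scalerAl mulr_sumr; congr (_ *: _).
by apply: eq_bigr => s _; rewrite scalerAr.
Qed.

Lemma eval_at_mul_rev (f g : series B) :
  eval_at (fun r s => g s * f r) = (sshift b g : series B) * (sshift a f : series B).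
Proof.
apply/funext=> k; rewrite seriesM -[RHS]/(sconv _ _ _) sconv_rev.
apply: eq_bigr => i _; rewrite {1}/sshift [in RHS]/sshift mulr_sumr.
apply: eq_bigr => r _; rewrite -scalerAr mulr_suml; congr (_ *: _).
by apply: eq_bigr => s _; rewrite scalerAl.
Qed.

End Evaluation.

(** * The RTT relation at parameters differing by one *)

Section RTT.
Variables (F : fieldType) (N : nat) (B : algType F).
Variable t : 'I_N -> 'I_N -> nat -> B.
Hypothesis rtt : forall r s, rtt_defect t r s = 0.

Local Notation K := (kappa F N).
Local Notation E2 := ('M[B]_(#|tbasis N 2|)).

Definition intext (G : series (series B)) (r s : int) : B :=
  if r is Posz r' then if s is Posz s' then G r' s' else 0 else 0.

Lemma intext_delay1 G r s : intext (delay1 G) r s = intext G (r - 1) s.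
Proof.
case: r s => [[|r]|r] [s|s] //; rewrite (_ : r.+1%:Z - 1 = r) //.
all: by rewrite -addn1 PoszD addrK.
Qed.

Lemma intext_delay2 G r s : intext (delay2 G) r s = intext G r (s - 1).
Proof.
case: r s => [r|r] [[|s]|s] //; rewrite (_ : s.+1%:Z - 1 = s) //.
all: by rewrite -addn1 PoszD addrK.
Qed.

Lemma umv_intext c (M : int -> int -> E2) x y G r0 s0 :
  (forall r s, M r s x y = intext G (r + r0) (s + s0)) ->
  forall r s, umv c M r s x y = intext (uminusv c G) (r + (r0 + 1)) (s + (s0 + 1)).
Proof.
move=> h r s; rewrite !mxE !h.
rewrite (_ : r + 1 + r0 = r + (r0 + 1)); last by rewrite -addrA (addrC 1).
rewrite (_ : s + 1 + s0 = s + (s0 + 1)); last by rewrite -addrA (addrC 1).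
have -> : s + s0 = s + (s0 + 1) - 1 by rewrite addrA addrK.
have -> : r + r0 = r + (r0 + 1) - 1 by rewrite addrA addrK.
rewrite -!intext_delay2 -!intext_delay1 /intext.
by case: (r + _) (s + _) => [r'|r'] [s'|s'] /=; rewrite ?mulr0 ?subrr // mulr_algl.
Qed.

Lemma PopM_pair (M : E2) i j z :
  (Pop N B ord0 ord_max *m M) (tpair i j) z = M (tpair j i) z.
Proof.
rewrite mxE sum_pair (bigD1 j) //= [X in _ + X]big1 ?addr0; last first.
  move=> c /negPf nc; apply: big1 => d _.
  by rewrite Pop_pair [j == c]eq_sym nc andbF mul0r.
rewrite (bigD1 i) //= big1 ?addr0; last first.
  by move=> d /negPf nd; rewrite Pop_pair [i == d]eq_sym nd mul0r.
by rewrite Pop_pair !eqxx mul1r.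
Qed.

Lemma mulPop_pair (M : E2) z k l :
  (M *m Pop N B ord0 ord_max) z (tpair k l) = M z (tpair l k).
Proof.
rewrite mxE sum_pair (bigD1 l) //= [X in _ + X]big1 ?addr0; last first.
  by move=> c /negPf nc; apply: big1 => d _; rewrite Pop_pair nc mulr0.
rewrite (bigD1 k) //= big1 ?addr0; last first.
  by move=> d /negPf nd; rewrite Pop_pair nd andbF mulr0.
by rewrite Pop_pair !eqxx mulr1.
Qed.

Lemma QopM_pair (M : E2) i j z :
  (Qop N B ord0 ord_max *m M) (tpair i j) z =
  (j == rev_ord i)%:R * \sum_c M (tpair c (rev_ord c)) z.
Proof.
rewrite mxE sum_pair mulr_sumr; apply: eq_bigr => c _.
rewrite (bigD1 (rev_ord c)) //= big1 ?addr0.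
  by rewrite Qop_pair eqxx andbT.
by move=> d /negPf nd; rewrite Qop_pair nd andbF mul0r.
Qed.

Lemma mulQop_pair (M : E2) z k l :
  (M *m Qop N B ord0 ord_max) z (tpair k l) =
  (l == rev_ord k)%:R * \sum_c M z (tpair c (rev_ord c)).
Proof.
rewrite mxE sum_pair mulr_sumr; apply: eq_bigr => c _.
rewrite (bigD1 (rev_ord c)) //= big1 ?addr0.
  by rewrite Qop_pair eqxx /= commr_nat.
by move=> d /negPf nd; rewrite Qop_pair nd mulr0.
Qed.

Definition entry12 i j k l : series (series B) := fun r s => t i k r * t j l s.
Definition entry21 i j k l : series (series B) := fun r s => t j l s * t i k r.

Lemma T12_pair r s i j k l :
  T12 t r s (tpair i j) (tpair k l) = intext (entry12 i j k l) (r + 0) (s + 0).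
Proof.
rewrite !addr0 /T12; case: r s => [r|r] [s|s] /=; rewrite ?mulmx0 ?mul0mx ?mxE //.
rewrite sum_pair (bigD1 k) //= [X in _ + X]big1 ?addr0; last first.
  by move=> c /negPf nc; apply: big1 => d _; rewrite Top1_pair nc !mulr0.
rewrite (bigD1 j) //= big1 ?addr0; last first.
  by move=> d /negPf nd; rewrite Top0_pair [j == d]eq_sym nd mulr0 mul0r.
by rewrite Top0_pair Top1_pair !eqxx !mulr1.
Qed.

Lemma T21_pair r s i j k l :
  T21 t r s (tpair i j) (tpair k l) = intext (entry21 i j k l) (r + 0) (s + 0).
Proof.
rewrite !addr0 /T21; case: r s => [r|r] [s|s] /=; rewrite ?mulmx0 ?mul0mx ?mxE //.
rewrite sum_pair (bigD1 i) //= [X in _ + X]big1 ?addr0; last first.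
  by move=> c /negPf nc; apply: big1 => d _; rewrite Top1_pair [i == c]eq_sym nc mulr0
      mul0r.
rewrite (bigD1 l) //= big1 ?addr0; last first.
  by move=> d /negPf nd; rewrite Top0_pair nd !mulr0.
by rewrite Top0_pair Top1_pair !eqxx !mulr1.
Qed.

(** The entries of the RTT relation, shifted by two in both exponents in order to
    clear the poles of (u - v)(u - v - kappa). *)
Lemma rtt_double_series i j k l :
  uminusv 0 (uminusv K (entry12 i j k l))
  - delay1 (delay2 (uminusv K (entry12 j i k l)))
  + (j == rev_ord i)%:R *:
     \sum_c delay1 (delay2 (uminusv 0 (entry12 c (rev_ord c) k l)))
  = uminusv 0 (uminusv K (entry21 i j k l))
  - delay1 (delay2 (uminusv K (entry21 i j l k)))
  + (l == rev_ord k)%:R *: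
     \sum_c delay1 (delay2 (uminusv 0 (entry21 i j c (rev_ord c)))).
Proof.
apply/funext=> r; apply/funext=> s.
have subE (M M' : E2) x y : (M - M') x y = M x y - M' x y by rewrite !mxE.
have addE (M M' : E2) x y : (M + M') x y = M x y + M' x y by rewrite !mxE.
have E12 i j k l := umv_intext _ (fun r s => T12_pair r s i j k l).
have E21 i j k l := umv_intext _ (fun r s => T21_pair r s i j k l).
have := congr1 (fun M : E2 => M (tpair i j) (tpair k l)) (rtt (r%:Z - 2) (s%:Z - 2)).
rewrite /rtt_defect /Rleft /Rright [LHS]subE [RHS]mxE => /subr0_eq.
rewrite [LHS]addE [X in X + _]subE [RHS]addE [X in _ = X + _]subE.
rewrite PopM_pair mulPop_pair QopM_pair mulQop_pair.
rewrite (umv_intext 0 (E12 K i j k l)).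
rewrite (umv_intext 0 (E21 K i j k l)).
rewrite (E12 K j i k l).
rewrite (E21 K i j l k).
under eq_bigr do rewrite E12.
under [X in _ = _ + _ * X]eq_bigr do rewrite E21.
have e1 (z : int) : z - 2 + (0 + 1) = z - 1 by rewrite add0r -addrA.
have e2 (z : int) : z - 2 + (0 + 1 + 1) = z by rewrite add0r -addrA addr0.
rewrite !e1 !e2.
under eq_bigr do rewrite -intext_delay2 -intext_delay1.
under [X in _ = _ + _ * X]eq_bigr do rewrite -intext_delay2 -intext_delay1.
rewrite -!intext_delay2 -!intext_delay1 /= => h.
rewrite !(seriesD, seriesZ, series_sum).
have natE (e : bool) (x : B) : e%:R * x = (e%:R : F) *: x.
  by rewrite scaler_nat mulr_natl.
by rewrite !natE in h.
Qed.

Variables a b : F.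

Let A i k : series B := sshift a (t i k).
Let A' i k : series B := sshift b (t i k).

(** The RTT relation may be specialized to u+a and u+b: both sides are multiplied
    by the inverses of (u+a)^2 and (u+b)^2, which cancel. *)
Lemma rtt_series i j k l :
  (a - b) *: ((a - b - K) *: (A i k * A' j l)) - (a - b - K) *: (A j k * A' i l)
  + (a - b) *: ((j == rev_ord i)%:R *: \sum_c A c k * A' (rev_ord c) l)
  = (a - b) *: ((a - b - K) *: (A' j l * A i k)) - (a - b - K) *: (A' j k * A i l)
  + (a - b) *: ((l == rev_ord k)%:R *: \sum_c A' j (rev_ord c) * A i c).
Proof.
(* [L] is the common shape of the two sides, so that linearity is used once. *)
pose L (g : 'I_N -> 'I_N -> 'I_N -> 'I_N -> series (series B)) (g' e : series (series B)) :=
  (a - b) *: ((a - b - K) *: g i j k l) - (a - b - K) *: g'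
   + (a - b) *: e : series (series B).
have evL g g' e : eval_at a b (L g g' e) = (a - b) *: ((a - b - K) *: eval_at a b (g i
    j k l))
    - (a - b - K) *: eval_at a b g' + (a - b) *: eval_at a b e.
  by rewrite /L raddfD raddfB /= !eval_atZ.
pose e12 : series (series B) := (j == rev_ord i)%:R *: \sum_c entry12 c (rev_ord c) k l.
pose e21 : series (series B) := (l == rev_ord k)%:R *: \sum_c entry21 i j c (rev_ord c).
have e12E : eval_at a b e12 = (j == rev_ord i)%:R *: \sum_c A c k * A' (rev_ord c) l.
  by rewrite eval_atZ raddf_sum; congr (_ *: _); apply: eq_bigr => c _; apply: eval_at_mul.
have e21E : eval_at a b e21 = (l == rev_ord k)%:R *: \sum_c A' j (rev_ord c) * A i c.
  by rewrite eval_atZ raddf_sum; congr (_ *: _); apply: eq_bigr => c _; apply: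
      eval_at_mul_rev.
suff: eval_at a b (L entry12 (entry12 j i k l) e12) = eval_at a b (L entry21 (entry21 i
    j l k) e21).
  by rewrite !evL e12E e21E !eval_at_mul !eval_at_mul_rev.
apply/eqP; rewrite -subr_eq0 -raddfB; apply/eqP.
do 2![apply: (eval_at_delay1_inj (a := a) (b := b)); apply: (eval_at_delay2_inj (a :=
    a) (b := b))].
pose D4 G := delay2 (delay1 (delay2 (delay1 G))) : series (series B).
have e1 c d G : eval_at a b (uminusv c (uminusv d G)) = (a - b - c) *: ((a - b - d) *:
    eval_at a b (D4 G)).
  by rewrite eval_at_uminusv uminusv_delay eval_at_uminusv /D4 !delay12.
have e2 c G : eval_at a b (delay1 (delay2 (uminusv c G))) = (a - b - c) *: eval_at a b
    (D4 G).
  by rewrite uminusv_delay eval_at_uminusv /D4 !delay12.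
have evD4 g g' e : eval_at a b (D4 (L g g' e)) = (a - b) *: ((a - b - K) *: eval_at a b
    (D4 (g i j k l)))
    - (a - b - K) *: eval_at a b (D4 g') + (a - b) *: eval_at a b (D4 e).
  by rewrite /L /D4 !raddfD !raddfN /= !(delay1Z, delay2Z, eval_atZ).
apply/eqP; rewrite !raddfB subr_eq0; apply/eqP.
rewrite -[LHS]/(eval_at a b (D4 (L entry12 _ _))) -[RHS]/(eval_at a b (D4 (L entry21 _
    _))) !evD4.
have evX X1 X2 c X3 : eval_at a b (X1 - X2 + c *: X3) = eval_at a b X1 - eval_at a b X2
    + c *: eval_at a b X3.
  by rewrite raddfD raddfB /= eval_atZ.
have evS (f : 'I_N -> series (series B)) :
    eval_at a b (\sum_c delay1 (delay2 (uminusv 0 (f c)))) = (a - b - 0) *: eval_at a b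
        (D4 (\sum_c f c)).
  rewrite raddf_sum /D4 !raddf_sum.
  by apply: eq_bigr => c _; exact: e2.
have := congr1 (eval_at a b) (rtt_double_series i j k l).
rewrite !evX (e1 0 K (entry12 i j k l)) (e1 0 K (entry21 i j k l)).
rewrite (e2 K (entry12 j i k l)) (e2 K (entry21 i j l k)).
rewrite (evS (fun c => entry12 c (rev_ord c) k l)) (evS (fun c => entry21 i j c
    (rev_ord c))).
have D4Z c G : eval_at a b (D4 (c *: G)) = c *: eval_at a b (D4 G).
  by rewrite /D4 !(delay1Z, delay2Z, eval_atZ).
rewrite !subr0 /e12 /e21 !D4Z => h.
by rewrite ![(a - b) *: (_%:R *: _)]scalerA ![(a - b) * _%:R]mulrC -!scalerA.
Qed.

End RTT.

Section TwoLegs.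
Variables (F : fieldType) (N : nat) (B : algType F).
Variable t : 'I_N -> 'I_N -> nat -> B.
Hypothesis rtt : forall r s, rtt_defect t r s = 0.
Hypotheses (F0 : [pchar F] =i pred0) (N_gt0 : (0 < N)%N).
Variable a : F.

Let A i k : series B := sshift a (t i k).
Let A' i k : series B := sshift (a + 1) (t i k).

(** For b = a+1 the relation says that R(-1) T_1 T_2 = T_2 T_1 R(-1) up to the
    factor N/2.  Applied to a row vector g with g R(-1) = 2 g, it gives
    N g T_1 T_2 = (N/2) g T_2 T_1 R(-1), which is symmetric and traceless because
    R(-1) is. *)
Lemma two_legs_harmonic (g : 'I_N -> 'I_N -> F) :
  (forall i j, g i j = g j i) -> \sum_i g i (rev_ord i) = 0 ->
  let h k l := \sum_i \sum_j g i j *: (A i k * A' j l) in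
  (forall k l, h k l = h l k) /\ \sum_k h k (rev_ord k) = 0.
Proof.
move=> gS gC h.
pose q i j k l := A' j l * A i k.
have q1 k l : \sum_i \sum_j g i j *: (A j k * A' i l) = h k l.
  rewrite exchange_big; apply: eq_bigr => i _; apply: eq_bigr => j _.
  by rewrite gS.
have N0 : N%:R != 0 :> F by rewrite (proj1 (pcharf0P _) F0) -lt0n.
have n2 : 2 != 0 :> F by rewrite (proj1 (pcharf0P _) F0).
have half : N%:R / 2 + N%:R / 2 = N%:R :> F by field.
pose S (f : 'I_N -> 'I_N -> series B) : series B := \sum_i \sum_j g i j *: f i j.
have SX c1 f1 c2 f2 c3 f3 : S (fun i j => c1 *: f1 i j + c2 *: f2 i j - c3 i j *: f3 i j)
    = c1 *: S f1 + c2 *: S f2 - S (fun i j => c3 i j *: f3 i j).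
  rewrite /S !scaler_sumr -big_split -sumrB; apply: eq_bigr => i _.
  rewrite /= !scaler_sumr -big_split -sumrB; apply: eq_bigr => j _.
  by rewrite scalerBr scalerDr !scalerA ![g i j * _]mulrC.
have Sdelta C : S (fun i j => (j == rev_ord i)%:R *: C) = 0.
  transitivity (\sum_i g i (rev_ord i) *: C); last by rewrite -scaler_suml gC scale0r.
  apply: eq_bigr => i _; rewrite (bigD1 (rev_ord i)) //= eqxx scale1r big1 ?addr0 //.
  by move=> j /negPf ->; rewrite scale0r scaler0.
have hE k l : N%:R *: h k l = (N%:R / 2) *: S (fun i j => q i j k l)
   + (N%:R / 2) *: S (fun i j => q i j l k)
   - (l == rev_ord k)%:R *: \sum_c S (fun i j => q i j c (rev_ord c)).
  have E i j : (N%:R / 2) *: (A i k * A' j l) + (N%:R / 2) *: (A j k * A' i l)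
      - (j == rev_ord i)%:R *: \sum_c A c k * A' (rev_ord c) l
    = (N%:R / 2) *: q i j k l + (N%:R / 2) *: q i j l k
      - (l == rev_ord k)%:R *: \sum_c q i j c (rev_ord c).
    have := rtt_series rtt a (a + 1) i j k l.
    have -> : a - (a + 1) = -1 by rewrite opprD addrA subrr add0r.
    have -> : -1 - kappa F N = - (N%:R / 2) by rewrite /kappa opprB addrA addNr add0r.
    by rewrite !scaleN1r !scaleNr !opprK.
  have := congr1 S (funext (fun i => funext (E i))).
  rewrite !SX Sdelta subr0 [S (fun i j => A j k * _)]q1 -scalerDl half => ->.
  congr (_ - _); rewrite /S [in RHS]exchange_big scaler_sumr; apply: eq_bigr => i _ /=.
  rewrite [in RHS]exchange_big scaler_sumr; apply: eq_bigr => j _ /=.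
  by rewrite -scaler_sumr !scalerA mulrC.
have hS k l : h k l = h l k.
  apply: (scalerI N0); rewrite !hE; rewrite [X in X - _]addrC; congr (_ - _%:R *: _).
  by rewrite -(inj_eq rev_ord_inj) rev_ordK eq_sym.
split=> //; apply: (scalerI N0); rewrite scaler_sumr scaler0.
under eq_bigr do rewrite hE eqxx scale1r.
rewrite sumrB big_split /= -!scaler_sumr sumr_const card_ord.
set X := \sum_k _; set X' := \sum_k _.
have -> : X' = X.
  by rewrite /X' (reindex_inj rev_ord_inj) /=; apply: eq_bigr => c _; rewrite rev_ordK.
by rewrite -scalerDl half scaler_nat subrr.
Qed.
End TwoLegs.

(** * Products of matrix entries preserve harmonicity *)

Section ManyLegs.
Variables (F : fieldType) (N m : nat) (B : algType F).
Local Notation idx := {ffun 'I_m -> 'I_N}.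
Local Notation rk y := (enum_rank (y : tbasis N m)).
Variable t : 'I_N -> 'I_N -> nat -> B.

Lemma Top_entry (a : 'I_m) (f : 'I_N -> 'I_N -> nat -> B) r (x y : idx) :
  Top a f r (rk x) (rk y) =
  [forall b, (b != a) ==> (x b == y b)]%:R * f (x a) (y a) r.
Proof.
rewrite /Top summxE (bigD1 (x a)) //= [X in _ + X]big1 ?addr0; last first.
  move=> i /negPf ni; rewrite summxE big1 // => j _.
  by rewrite !mxE !tindexK eq_sym ni mulr0.
rewrite summxE (bigD1 (y a)) //= [X in _ + X]big1 ?addr0; last first.
  by move=> j /negPf nj; rewrite !mxE !tindexK [y a == j]eq_sym nj andbF mulr0.
by rewrite !mxE !tindexK !eqxx /= commr_nat.
Qed.

Definition leg (a : 'I_m) (x y : idx) : series B := sshift (a%:R : F) (t (x a) (y a)).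

Definition legs (x y : idx) : series B := \prod_(a < m) leg a x y.

Let T (a : 'I_m) : nat -> 'M[B]_(#|tbasis N m|) :=
  Top a (fun i j => sshift a%:R (t i j)).

(** T_a changes only the index of the copy a, so in the product over distinct
    copies a single path of intermediate indices contributes. *)
Lemma Top_prod_entry (s : seq 'I_m) r (x y : idx) : uniq s ->
  (\big[@sconv _ / sone _]_(a <- s) T a) r (rk x) (rk y) =
  [forall b, (b \notin s) ==> (x b == y b)]%:R * (\prod_(a <- s) leg a x y) r.
Proof.
elim: s r x y => [|a s IH] r x y /=.
  move=> _; rewrite !big_nil /sone.
  have -> : [forall b, (b \notin [::]) ==> (x b == y b)] = (x == y).
    apply/forallP/eqP => [h|-> b]; last by rewrite eqxx implybT.
    by apply/ffunP=> b; apply/eqP; move: (h b); rewrite in_nil.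
  rewrite -[(1 : series B) r]/(sone B r) /sone.
  case: (r == 0%N); last by rewrite mxE mulr0.
  by rewrite mxE (inj_eq enum_rank_inj) mulr1.
case/andP=> as_ us; rewrite !big_cons {1}/sconv summxE seriesM mulr_sumr.
apply: eq_bigr => k _; rewrite -mulmxE mxE (bigD1 (rk (set_leg x a (y a)))) //= big1 ?addr0.
  rewrite Top_entry IH // ffunE eqxx.
  have -> : [forall b, (b != a) ==> (x b == set_leg x a (y a) b)].
    by apply/forallP=> b; apply/implyP=> /negPf ba; rewrite ffunE ba.
  have -> : [forall b, (b \notin s) ==> (set_leg x a (y a) b == y b)]
          = [forall b, (b \notin a :: s) ==> (x b == y b)].
    apply: eq_forallb => b; rewrite ffunE inE negb_or; case: (b =P a) => [->|_] //=.
    by rewrite eqxx implybT.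
  have -> : \prod_(j <- s) leg j (set_leg x a (y a)) y = \prod_(j <- s) leg j x y.
    apply: eq_big_seq => j js; rewrite /leg ffunE; case: eqP => // ja.
    by rewrite -ja js in as_.
  by rewrite mul1r /leg; case: [forall b, _]; rewrite ?mul1r ?mul0r ?mulr0.
move=> z; rewrite -[z]enum_valK => zn; set w := enum_val z in zn *.
rewrite Top_entry IH //; case: forallP => [h1|_]; last by rewrite !mul0r.
case: forallP => [h2|_]; last by rewrite mul0r mulr0.
case/eqP: zn; congr (enum_rank _); apply/ffunP=> b; rewrite ffunE.
case: eqP => [->|/eqP ba]; first by apply/eqP; move: (h2 a); rewrite as_.
by apply/esym/eqP; move: (h1 b); rewrite ba.
Qed.

Lemma Top_prodE r (x y : idx) :
  (\big[@sconv _ / sone _]_(a < m) T a) r (rk x) (rk y) = legs x y r.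
Proof.
rewrite Top_prod_entry ?index_enum_uniq // (_ : [forall b, _]) ?mul1r //.
by apply/forallP=> b; rewrite mem_index_enum.
Qed.

(** Averaging over the index of one copy: a sum over all tensors can be organized
    as a sum over the indices of chosen copies without splitting the index set. *)
Lemma sum_set_leg (V : zmodType) (G : idx -> V) (p : 'I_m) :
  \sum_x \sum_i G (set_leg x p i) = (\sum_x G x) *+ N.
Proof.
pose h (z : idx * 'I_N) := (set_leg z.1 p z.2, z.1 p).
have hK : involutive h.
  by move=> [x i]; rewrite /h /= set_legK set_leg_id ffunE eqxx.
rewrite pair_bigA (reindex_inj (can_inj hK)) /=.
rewrite -(pair_bigA _ (fun x i => G (set_leg (set_leg x p i) p (x p)))) /= -sumrMnl.
apply: eq_bigr => x _; under eq_bigr do rewrite set_legK set_leg_id.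
by rewrite sumr_const card_ord.
Qed.

Hypothesis rtt : forall r s, rtt_defect t r s = 0.
Hypotheses (F0 : [pchar F] =i pred0) (N_gt0 : (0 < N)%N).

Definition row_legs (f : idx -> F) (y : idx) : series B := \sum_x f x *: legs x y.

(** Freezing all copies except p and q = p+1 leaves two adjacent factors with
    parameters u+p and u+p+1, to which [two_legs_harmonic] applies; the factors on
    the left and on the right do not depend on the indices at p and q. *)
Lemma row_legs_harmonic (p q : 'I_m) f : q = p.+1 :> nat ->
  harmonic p q f -> harmonic p q (row_legs f).
Proof.
move=> qp [fS fC]; have lt_pq : (p < q)%N by rewrite qp.
have pq : p != q by rewrite neq_ltn lt_pq.
pose L x y := \prod_(a <- take p (enum 'I_m)) leg a x y.
pose R x y := \prod_(a <- drop q.+1 (enum 'I_m)) leg a x y.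
pose tt i j k l : series B :=
  (sshift (p%:R : F) (t i k) : series B) * (sshift (p%:R + 1 : F) (t j l) : series B).
have legsE x y : legs x y = L x y * tt (x p) (x q) (y p) (y q) * R x y.
  rewrite /legs -[index_enum _]enumT -(cat_take_drop p (enum _)) big_cat /= drop_enum.
  rewrite (_ : p.+1 = q) // drop_enum !big_cons -/(L x y) -/(R x y) !mulrA.
  by rewrite /tt /leg [in q%:R]qp -natr1.
have inL a : a \in take p (enum 'I_m) -> (a != p) && (a != q).
  move=> /enum_take_lt h; have hq : (a < q)%N by rewrite qp ltnW.
  by rewrite !neq_ltn h hq.
have inR a : a \in drop q.+1 (enum 'I_m) -> (a != p) && (a != q).
  move=> /enum_drop_ge h; have hp : (p < a)%N by rewrite (ltn_trans _ h) // qp.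
  by rewrite !neq_ltn h hp !orbT.
pose u (x : idx) i j := set_leg (set_leg x q j) p i.
have offu (s : seq 'I_m) x i j y k l :
    (forall a, a \in s -> (a != p) && (a != q)) ->
    \prod_(a <- s) leg a (u x i j) (u y k l) = \prod_(a <- s) leg a x y.
  move=> h; apply: eq_big_seq => a /h /andP[/negPf ap /negPf aq].
  by rewrite /leg !ffunE ap aq.
pose h x k l := \sum_i \sum_j f (u x i j) *: tt i j k l.
have hh x : (forall k l, h x k l = h x l k) /\ \sum_k h x k (rev_ord k) = 0.
  apply: (two_legs_harmonic rtt F0 N_gt0 p%:R (g := fun i j => f (u x i j))).
    by move=> i j; rewrite -fS swap_set_leg2.
  exact: fC.
(* The factor N^2 comes from summing twice over the indices at p and q. *)
have rE y k l : (N * N)%:R *: row_legs f (u y k l) = \sum_x L x y * h x k l * R x y.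
  rewrite natrM -scalerA !scaler_nat -(sum_set_leg _ p) -(sum_set_leg _ q).
  apply: eq_bigr => x _; rewrite exchange_big /= mulr_sumr mulr_suml.
  apply: eq_bigr => i _; rewrite mulr_sumr mulr_suml; apply: eq_bigr => j _.
  rewrite -/(u x i j) legsE /L /R !offu // -scalerAr -scalerAl.
  by rewrite !ffunE !eqxx [q == p]eq_sym (negPf pq).
have NN0 : (N * N)%:R != 0 :> F by rewrite natr_gt0_neq0 // muln_gt0 N_gt0.
have yE y : y = u y (y p) (y q) by rewrite /u !set_leg_id.
split=> y; apply: (scalerI NN0).
  rewrite (yE y) swap_set_leg2 // -!/(u _ _ _) !rE; apply: eq_bigr => x _.
  by rewrite (proj1 (hh x)).
rewrite /contraction scaler_sumr scaler0; under eq_bigr do rewrite rE.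
rewrite exchange_big big1 // => x _.
by rewrite -mulr_suml -mulr_sumr (proj2 (hh x)) mulr0 mul0r.
Qed.

End ManyLegs.

(** * Reduced monomials modulo the quadric *)

Section Symmetric.
Variables (N m : nat) (V : zmodType).
Local Notation idx := {ffun 'I_m -> 'I_N}.
Implicit Types f : idx -> V.

Lemma harmonic_conj (e e' a b : 'I_m) f :
  (forall y, f (swap_legs e e' y) = f y) -> harmonic a b f ->
  harmonic (tperm e e' a) (tperm e e' b) f.
Proof.
move=> fS [fab fC].
have su c i (y : idx) : swap_legs e e' (set_leg y (tperm e e' c) i) = set_leg
    (swap_legs e e' y) c i.
  by apply/ffunP=> z; rewrite !ffunE (inj_eq perm_inj).
split=> y.
  rewrite -fS -[RHS]fS -[RHS]fab; congr f.
  by rewrite (swap_legsE (tperm _ _ a)) !su (swap_legsE a b) !ffunE.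
rewrite /contraction -[RHS](fC (swap_legs e e' y)); apply: eq_bigr => k _.
by rewrite -fS !su.
Qed.

Definition harmonic_tensor f := forall a b, a != b -> harmonic a b f.

(** Conjugation by the transposition of b-1 and b carries harmonicity in a, b-1 to
    harmonicity in a, b. *)
Lemma adjacent_harmonic f :
  (forall p q : 'I_m, q = p.+1 :> nat -> harmonic p q f) -> harmonic_tensor f.
Proof.
move=> fh.
have lt (d : nat) (a b : 'I_m) : b = (a + d).+1 :> nat -> harmonic a b f.
  elim: d b => [|d IH] b bE; first by apply: fh; rewrite bE addn0.
  have b'm : ((a + d).+1 < m)%N by rewrite -addnS -ltnS -bE ltnS ltnW.
  pose b' := Ordinal b'm.
  have bb' : b = b'.+1 :> nat by rewrite bE addnS.
  have := harmonic_conj (proj1 (fh b' b bb')) (IH b' erefl).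
  rewrite tpermL tpermD //; rewrite -val_eqE /= ?bE neq_ltn.
    by rewrite ltnS leq_addr orbT.
  by rewrite ltnS leq_addr orbT.
have {}lt (a b : 'I_m) : (a < b)%N -> harmonic a b f.
  by move=> ab; apply: (lt (b - a.+1)%N); rewrite -addSn subnKC.
move=> a b; rewrite neq_ltn => /orP[/lt//|/lt h].
by have := harmonic_conj (proj1 h) h; rewrite tpermL tpermR.
Qed.

Lemma harmonic_perm f (s : 'S_m) (y : idx) :
  harmonic_tensor f -> f [ffun c => y (s c)] = f y.
Proof.
move=> fh; case: (prod_tpermP s) => ts -> _ {s}.
elim: ts y => [|[a b] ts IH] y.
  by congr f; apply/ffunP=> c; rewrite ffunE big_nil perm1.
rewrite big_cons /= -[RHS]IH; case: (eqVneq a b) => [->|ab].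
  by rewrite tperm1 mul1g.
rewrite -[RHS](proj1 (fh a b ab)); congr f; apply/ffunP=> c.
by rewrite !ffunE permM.
Qed.

End Symmetric.

Section Counts.
Variables (N m : nat).
Local Notation idx := {ffun 'I_m -> 'I_N}.

Definition weakly_increasing (y : idx) :=
  [forall a : 'I_m, forall b : 'I_m, (a <= b)%N ==> (y a <= y b)%N].

Lemma weakly_increasingP (y : idx) :
  reflect (forall a b : 'I_m, (a <= b)%N -> (y a <= y b)%N) (weakly_increasing y).
Proof.
apply: (iffP forallP) => [h a b|h a]; first by move/forallP/(_ b)/implyP: (h a).
by apply/forallP=> b; apply/implyP; apply: h.
Qed.

Lemma weakly_increasing_sorted (y : idx) :
  weakly_increasing y = sorted (relpre val leq) [seq y a | a <- enum 'I_m].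
Proof.
have tr : transitive (relpre (val : 'I_N -> nat) leq).
  by move=> b a c; apply: leq_trans.
rewrite sorted_pairwise // pairwise_map; case: (posnP m) => [m0|m_gt0].
  rewrite (size0nil (etrans (size_enum_ord m) m0)).
  by apply/weakly_increasingP=> a; have := ltn_ord a; rewrite {2}m0.
apply/weakly_increasingP/(pairwiseP (Ordinal m_gt0)) => h a b.
  rewrite !inE size_enum_ord => am bm ab.
  by apply: h; rewrite !nth_enum_ord // ltnW.
rewrite leq_eqVlt => /orP[/eqP/val_inj-> //|ab].
have := h a b; rewrite !inE size_enum_ord !ltn_ord !nth_ord_enum.
by apply.
Qed.

Lemma sort_idx (y : idx) :
  exists s : 'S_m, weakly_increasing [ffun c => y (s c)].
Proof.
pose r := relpre (val : 'I_N -> nat) leq.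
have /tuple_permP[s sE] : perm_eq (sort r [tuple y a | a < m]) [tuple y a | a < m].
  by rewrite perm_sort.
exists s; rewrite weakly_increasing_sorted.
have -> : [seq [ffun c => y (s c)] a | a <- enum 'I_m] = sort r [tuple y a | a < m].
  by rewrite sE; apply: eq_map => a; rewrite ffunE tnth_mktuple.
by apply: sort_sorted => a b; apply: leq_total.
Qed.

(** The exponents of the monomial prod_a z_{y_a}. *)
Definition content (y : idx) : {ffun 'I_N -> nat} := [ffun v => (\sum_a (y a == v))%N].

Lemma content_swap a b (y : idx) : content (swap_legs a b y) = content y.
Proof.
apply/ffunP=> v; rewrite !ffunE [RHS](reindex_inj (@perm_inj _ (tperm a b))).
by apply: eq_bigr => c _; rewrite ffunE.
Qed.

Definition add_pair (al : {ffun 'I_N -> nat}) (v : 'I_N) : {ffun 'I_N -> nat} :=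
  [ffun w => al w + (w == v) + (w == rev_ord v)]%N.

Lemma content_set_leg2 (a b : 'I_m) (y : idx) k : a != b ->
  content (set_leg (set_leg y b (rev_ord k)) a k) =
  add_pair [ffun v => (\sum_(c | (c != a) && (c != b)) (y c == v))%N] k.
Proof.
move=> ab; apply/ffunP=> v; rewrite !ffunE.
rewrite (bigD1 a) //= (bigD1 b) 1?eq_sym //= !ffunE !eqxx [b == a]eq_sym (negPf ab).
rewrite ![v == _]eq_sym addnA addnC addnA; congr (_ + _ + _)%N.
by apply: eq_bigr => c /andP[/negPf ca /negPf cb]; rewrite !ffunE ca cb.
Qed.

Lemma weakly_increasing_content_inj (y z : idx) :
  weakly_increasing y -> weakly_increasing z -> content y = content z -> y = z.
Proof.
rewrite !weakly_increasing_sorted => sy sz e.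
have cE (x : idx) v : count_mem v [seq x a | a <- enum 'I_m] = content x v.
  rewrite ffunE count_map -sum1_count big_mkcond enumT /=.
  by apply: eq_bigr => a _; case: eqP.
have /eq_in_map h : [seq y a | a <- enum 'I_m] = [seq z a | a <- enum 'I_m].
  apply: (sorted_eq _ _ sy sz).
  - by move=> b a c; apply: leq_trans.
  - by move=> a b /anti_leq /val_inj.
  - by apply/allP=> v _; rewrite /= !cE e.
by apply/ffunP=> a; apply: h; rewrite mem_enum.
Qed.

End Counts.

Section Reduction.
Variables (F : fieldType) (N m : nat).
Local Notation idx := {ffun 'I_m -> 'I_N}.
Hypothesis (F0 : [pchar F] =i pred0).
Variable lo : 'I_N.
Local Notation hi := (rev_ord lo).
Hypothesis lo_lt_hi : (lo < hi)%N.
Hypothesis outer : forall v, v != lo -> v != hi -> (hi < v)%N || (hi < rev_ord v)%N.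

(** The basis monomials, as sorted tensors.  The indices [lo] and its opposite hi
    are the two middle indices n and n'; what matters about them is that every
    other pair v, v' has a member above hi. *)
Definition reduced (y : idx) :=
  weakly_increasing y && ~~ ([exists a, y a == lo] && [exists a, y a == hi]).

Let lo_neq_hi : lo != hi. Proof. by rewrite neq_ltn lo_lt_hi. Qed.
Let n2 : 2 != 0 :> F. Proof. by rewrite (proj1 (pcharf0P _) F0). Qed.

Lemma add_pair_out al k : k != lo -> k != hi ->
  (add_pair al k lo = al lo) * (add_pair al k hi = al hi).
Proof.
move=> klo khi; rewrite !ffunE (inj_eq rev_ord_inj).
have -> : (lo == rev_ord k) = (k == hi).
  by rewrite -(inj_eq rev_ord_inj) rev_ordK eq_sym.
by rewrite [lo == k]eq_sym [hi == k]eq_sym (negPf klo) (negPf khi) !addn0.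
Qed.

(** The reduced monomials span: if both lo and hi occur, tracelessness expresses
    twice the value of f through tensors with fewer occurrences of lo; otherwise
    sorting gives a reduced tensor. *)
Lemma harmonic_eq0 (V : lmodType F) (f : idx -> V) :
  harmonic_tensor f -> (forall y, reduced y -> f y = 0) -> forall y, f y = 0.
Proof.
move=> fh f0 y; have [c] := ubnP (content y lo); elim: c y => // c IH y yc.
have [/andP[/existsP[a /eqP ya] /existsP[b /eqP yb]]|nred] :=
    boolP ([exists a, y a == lo] && [exists a, y a == hi]); last first.
  have [s ys] := sort_idx y; rewrite -(harmonic_perm s y fh); apply: f0.
  rewrite /reduced ys /=; apply: contra nred => /andP[/existsP[a h] /existsP[b h']].
  rewrite !ffunE in h h'.
  by apply/andP; split; apply/existsP; [exists (s a)|exists (s b)].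
have ab : a != b by apply: contraNneq lo_neq_hi => e; rewrite -yb -e ya.
have [fS fC] := fh a b ab.
pose u k := set_leg (set_leg y b (rev_ord k)) a k.
have ulo : u lo = y by rewrite /u -yb set_leg_id -ya set_leg_id.
have := fC y; rewrite /contraction (bigD1 lo) //= (bigD1 hi) 1?eq_sym //= big1 ?addr0.
  rewrite -/(u lo) -/(u hi) ulo.
  have -> : f (u hi) = f y by rewrite -(fS (u hi)) swap_set_leg2 // rev_ordK -/(u lo) ulo.
  by rewrite -mulr2n -scaler_nat => /eqP; rewrite scaler_eq0 (negPf n2) => /eqP.
move=> k /andP[klo khi]; apply: IH; rewrite -/(u k).
rewrite -ulo /u content_set_leg2 // in yc; rewrite /u content_set_leg2 // add_pair_out //.
by move: yc; rewrite [X in (X < _)%N -> _]ffunE eqxx (negPf lo_neq_hi) addn0 addn1.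
Qed.

(** Each step replaces one factor z_lo z_hi by
    - sum_{k < n} z_k z_k' = - (1/2) sum_v z_v z_v', where v runs over all other
    indices and so meets every pair twice; c counts the remaining steps. *)
Fixpoint reduction_rec (c : nat) (al be : {ffun 'I_N -> nat}) : F :=
  if c is c'.+1 then
    - 2^-1 * \sum_(v | (v != lo) && (v != hi))
       reduction_rec c' (add_pair [ffun w => al w - (w == lo) - (w == hi)]%N v) be
  else (al == be)%:R.

(** The coefficient of z in the normal form of y modulo the quadric. *)
Definition reduction (z y : idx) : F :=
  reduction_rec (minn (content y lo) (content y hi)) (content y) (content z).

(** In the contraction the terms k = lo and k = hi are equal, and the recursion
    makes each of them minus one half of the sum of the others. *)
Lemma reduction_harmonic z : harmonic_tensor (reduction z).
Proof.
move=> a b ab; split=> y; first by rewrite /reduction content_swap.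
rewrite /contraction /reduction; set base := [ffun v => (\sum_(c | (c != a) && (c !=
    b)) (y c == v))%N].
under eq_bigr do rewrite content_set_leg2 // -/base.
pose c := minn (base lo) (base hi).
have hi_neq_lo : hi != lo by rewrite eq_sym.
have outE k : k != lo -> k != hi -> minn (add_pair base k lo) (add_pair base k hi) = c.
  by move=> klo khi; rewrite !add_pair_out.
have hiE : add_pair base hi = add_pair base lo.
  by apply/ffunP=> w; rewrite !ffunE rev_ordK addnAC.
have minE : minn (add_pair base lo lo) (add_pair base lo hi) = c.+1.
  rewrite !ffunE !eqxx (negPf lo_neq_hi) (negPf hi_neq_lo) !addn0 !addn1 minnSS.
  by rewrite /c !ffunE.
have baseE : [ffun w => add_pair base lo w - (w == lo) - (w == hi)]%N = base.
  by apply/ffunP=> w; rewrite ffunE [add_pair _ _ _]ffunE subnAC !addnK.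
rewrite (bigD1 lo) //= (bigD1 hi) //= hiE minE /= baseE.
rewrite [X in _ + (_ + X)](eq_bigr (fun k => reduction_rec c (add_pair base k) (content
    z))); last first.
  by move=> k /andP[klo khi]; rewrite outE.
by field.
Qed.

Lemma reduction_reduced z y : reduced z -> reduced y -> reduction z y = (z == y)%:R.
Proof.
move=> /andP[sz _] /andP[sy]; rewrite negb_and /reduction => h.
have -> : minn (content y lo) (content y hi) = 0%N.
  by case/orP: h => /existsPn h; [rewrite [X in minn X _]ffunE|rewrite [X in minn _
      X]ffunE];
    rewrite big1 ?min0n ?minn0 // => a _; rewrite (negPf (h a)).
rewrite /=; congr (nat_of_bool _)%:R; apply/eqP/eqP => [e|-> //].
by apply/esym/weakly_increasing_content_inj.
Qed.

Definition same_weight (al be : {ffun 'I_N -> nat}) :=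
  forall v, (al v + be (rev_ord v) = al (rev_ord v) + be v)%N.

(** What the replacement of pairs lo, hi by outer pairs v, v' leaves between the
    exponents al of a monomial and be of one in its normal form: the outer
    exponents grow, the weight is kept, and some exponent above hi strictly grows
    unless nothing changes. *)
Definition reduction_rel (al be : {ffun 'I_N -> nat}) :=
  [/\ forall v, v != lo -> v != hi -> (al v <= be v)%N, same_weight al be
    & al = be \/ exists2 w : 'I_N, (hi < w)%N & (al w < be w)%N].

Lemma reduction_rec_rel c (al be : {ffun 'I_N -> nat}) : (c <= minn (al lo) (al hi))%N ->
  reduction_rec c al be != 0 -> reduction_rel al be.
Proof.
elim: c al => [|c IH] al /=.
  move=> _; case: (al =P be) => [-> _|]; last by rewrite eqxx.
  by split=> //; [move=> v; rewrite addnC|left].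
rewrite leq_min => /andP[clo chi]; rewrite mulf_eq0 negb_or => /andP[_ h].
have [v [vlo vhi hv]] : exists v, [/\ v != lo, v != hi &
    reduction_rec c (add_pair [ffun w => al w - (w == lo) - (w == hi)]%N v) be != 0].
  apply/not_existsP => H; case/eqP: h; apply: big1 => v /andP[vlo vhi].
  by apply/eqP/negPn/negP => n; apply: (H v).
set al1 := add_pair _ v in hv.
have al1E (w : 'I_N) : al1 w = (al w - (w == lo) - (w == hi) + (w == v) + (w == rev_ord
    v))%N.
  by rewrite !ffunE.
have [] := IH al1 _ hv.
  rewrite leq_min !al1E !eqxx (negPf lo_neq_hi) [hi == lo]eq_sym (negPf lo_neq_hi).
  by move: clo chi; clear; lia.
move=> h1 h2 _.
have le (w : 'I_N) : w != lo -> w != hi -> (al w + (w == v) + (w == rev_ord v) <= be w)%N.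
  by move=> wlo whi; have := h1 w wlo whi; rewrite al1E (negPf wlo) (negPf whi) !subn0.
have [vlo' vhi'] : rev_ord v != lo /\ rev_ord v != hi.
  by rewrite (inj_eq rev_ord_inj) vlo -(inj_eq rev_ord_inj) rev_ordK vhi.
split.
- by move=> w wlo whi; apply: leq_trans (le w wlo whi); rewrite -addnA leq_addr.
- move=> w; have := h2 w; rewrite !al1E.
  rewrite -[rev_ord w == lo](inj_eq rev_ord_inj) -[rev_ord w == v](inj_eq rev_ord_inj).
  rewrite rev_ordK !(inj_eq rev_ord_inj).
  move: (w == v) (w == rev_ord v) => b1 b2; move: lo_neq_hi.
  case: (w =P lo) => [->|_]; last case: (w =P hi) => [->|_]; rewrite ?rev_ordK.
  - by move=> /negPf ->; clear -clo chi; lia.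
  - by clear -clo chi; lia.
  by clear; lia.
right; case/orP: (outer vlo vhi) => hv'; [exists v|exists (rev_ord v)] => //.
  by apply: leq_trans (le v vlo vhi); rewrite eqxx addn1 leq_addr.
by apply: leq_trans (le _ vlo' vhi'); rewrite eqxx !addn1 ltnS leq_addr.
Qed.

(** Suppose that y_p > z_p at the last difference p, and let v = y_p.  Then v
    occurs more often in y than in z, so v is lo or hi, and y differs from z as a
    monomial; so some w above hi occurs more often in z than in y, hence at a place
    up to p.  As z is increasing, w is at most z_p < v, contrary to v <= hi < w. *)
Lemma reduction_dominance z y : reduction z y != 0 -> reduced z -> y != z ->
  exists2 p : 'I_m, (y p < z p)%N & forall q : 'I_m, (p < q)%N -> y q = z q.
Proof.
move=> /reduction_rec_rel [//|h1 _ h3] /andP[/weakly_increasingP sz _] yz.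
have [p0 yp0] : exists p, y p != z p.
  by apply/existsP; apply: contraNT yz => /existsPn h; apply/eqP/ffunP=> p; apply/eqP/negPn.
case: (@arg_maxnP _ p0 (fun p => y p != z p) val yp0) => p yp pmax.
have tail (q : 'I_m) : (p < q)%N -> y q = z q.
  by move=> pq; apply/eqP; apply: contraLR pq => /pmax; rewrite -leqNgt.
exists p => //; rewrite ltnNge leq_eqVlt negb_or -leqNgt eq_sym yp /= leqNgt.
apply/negP=> zy.
have big_v : (content z (y p) < content y (y p))%N.
  rewrite !ffunE (bigD1 p) //= [X in (_ < X)%N](bigD1 p) //= eqxx eq_sym (negPf yp).
  rewrite add0n add1n ltnS; apply: leq_sum => a _.
  case: (ltnP p a) => [/tail -> //|ap].
  by rewrite -val_eqE eqn_leq [(y p <= _)%N]leqNgt (leq_ltn_trans (sz _ _ ap) zy) andbF.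
have vhi : (y p <= hi)%N.
  case: (eqVneq (y p) lo) => [->|vlo]; first exact: ltnW.
  case: (eqVneq (y p) hi) => [->//|vhi].
  by move: big_v; rewrite ltnNge h1.
case: h3 => [e|[w whi]]; first by rewrite e ltnn in big_v.
rewrite ltnNge => /negP; apply; rewrite !ffunE; apply: leq_sum => a _.
case: (ltnP p a) => [/tail -> //|ap].
case: (z a =P w) => // zaw; have := leq_ltn_trans (sz _ _ ap) zy.
by rewrite zaw => wy; have := ltn_trans whi (leq_trans wy vhi); rewrite ltnn.
Qed.

End Reduction.

(** * The trace as a sum over reduced monomials *)

Section SsymFixes.
Variables (F : fieldType) (N m : nat).
Local Notation idx := {ffun 'I_m -> 'I_N}.
Hypothesis (F0 : [pchar F] =i pred0).

Lemma sfactor_scale (a b : 'I_m) c (f : idx -> F) : (a < b)%N -> harmonic_tensor f ->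
  sfactor a b (fun y => c * f y) = fun y => c * (1 + (b - a)%N%:R^-1) * f y.
Proof.
move=> ab /(_ a b) []; first by rewrite neq_ltn ab.
move=> sf cf; apply/funext=> y; rewrite /sfactor /rfactor sf.
by rewrite /contraction -mulr_sumr -/(contraction a b f y) cf !mulr0 subr0; ring.
Qed.

(** The product telescopes, since 1 + 1/k = (k+1)/k. *)
Lemma prod_ratio n : \prod_(1 <= k < n.+1) (1 + k%:R^-1 : F) = n.+1%:R.
Proof.
elim: n => [|n IH]; first by rewrite big_geq.
rewrite big_nat_recr //= IH mulrDr mulr1 mulfV; first by rewrite natr1.
by rewrite (proj1 (pcharf0P _) F0).
Qed.

Lemma srow_scale (a : 'I_m) c (f : idx -> F) : harmonic_tensor f ->
  srow a (fun y => c * f y) = fun y => c * (m - a)%:R * f y.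
Proof.
move=> hf; rewrite /srow.
transitivity (fun y =>
    c * \prod_(b <- drop a.+1 (enum 'I_m)) (1 + (b - a)%N%:R^-1) * f y).
  have: all (fun b : 'I_m => a < b)%N (drop a.+1 (enum 'I_m)).
    by apply/allP=> b /enum_drop_ge.
  elim: (drop _ _) c => [|b s IH] c /=; first by rewrite big_nil mulr1.
  by case/andP=> ab /IH {}IH; rewrite sfactor_scale // IH big_cons mulrA.
apply/funext=> y; congr (_ * _ * _).
have -> : \prod_(b <- drop a.+1 (enum 'I_m)) (1 + (b - a)%N%:R^-1)
        = \prod_(k <- map val (drop a.+1 (enum 'I_m))) (1 + (k - a)%N%:R^-1) :> F.
  by rewrite big_map.
rewrite map_drop val_enum_ord drop_iota add0n -{1}(addn1 a) iotaDl big_map.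
have -> : (m - a)%N = (m - a.+1).+1 by rewrite subnSK.
rewrite -prod_ratio /index_iota subSS subn0. apply: eq_bigr => k _.
by rewrite addKn.
Qed.

(** On a harmonic functional P_{ab} acts by 1 and Q_{ab} by 0, so the row a of the
    product contributes prod_{d} (d+1)/d = m - a (with a counted from 0), and all
    rows together m!, which the normalization cancels. *)
Lemma ract_Ssym_harmonic (f : idx -> F) : harmonic_tensor f ->
  ract f (Ssym N m F) = f.
Proof.
move=> hf; rewrite ract_Ssym.
have -> : foldl (fun g a => srow a g) f (enum 'I_m) =
    fun y => \prod_(a <- enum 'I_m) (m - a)%:R * f y.
  have H c s : foldl (fun g a => srow a g) (fun y => c * f y) s =
      fun y => c * \prod_(a <- s) (m - a)%:R * f y.
    elim: s c => [|a s IH] c /=; first by rewrite big_nil mulr1.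
    by rewrite srow_scale // IH big_cons mulrA.
  rewrite -[in LHS](_ : (fun y => 1 * f y) = f) ?H.
    by apply/funext=> y; rewrite mul1r.
  by apply/funext=> y; rewrite mul1r.
apply/funext=> y; rewrite big_enum /= mulrA (_ : \prod_(a < m) _ = m`!%:R).
  by rewrite mulVf ?mul1r // (proj1 (pcharf0P _) F0) -lt0n fact_gt0.
rewrite (reindex_inj rev_ord_inj) fact_prod big_add1 /= big_mkord -natr_prod.
congr (_%:R); apply: eq_bigr => a _ /=.
by rewrite subKn.
Qed.

End SsymFixes.

Section TraceFormula.
Variables (F : fieldType) (N m : nat) (B : algType F).
Local Notation idx := {ffun 'I_m -> 'I_N}.
Local Notation rk y := (enum_rank (y : tbasis N m)).
Variable t : 'I_N -> 'I_N -> nat -> B.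
Hypothesis rtt : forall r s, rtt_defect t r s = 0.
Hypothesis (F0 : [pchar F] =i pred0).
Variable lo : 'I_N.
Hypothesis lo_lt_hi : (lo < rev_ord lo)%N.

Let T (a : 'I_m) : nat -> 'M[B]_(#|tbasis N m|) :=
  Top a (fun i j => sshift a%:R (t i j)).

Let N_gt0 : (0 < N)%N.
Proof. exact: leq_ltn_trans (leq0n _) (ltn_ord lo). Qed.

Lemma harmonic_expand (f : idx -> series B) w : harmonic_tensor f ->
  f w = \sum_(j | reduced lo j) reduction F lo j w *: f j.
Proof.
move=> hf; apply/eqP; rewrite -subr_eq0; apply/eqP; move: w.
apply: (harmonic_eq0 F0 lo_lt_hi) => [a b ab|y ry].
  have [fS fC] := hf a b ab.
  split=> y.
    rewrite fS; congr (_ - _); apply: eq_bigr => j _.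
    by rewrite (proj1 (reduction_harmonic F0 lo_lt_hi j ab)).
  rewrite /contraction sumrB -/(contraction a b f y) fC sub0r exchange_big big1 ?oppr0
      // => j _.
  rewrite -scaler_suml -[\sum_k _]/(contraction a b (reduction F lo j) y).
  by rewrite (proj2 (reduction_harmonic F0 lo_lt_hi j ab)) scale0r.
rewrite (bigD1 y) //= reduction_reduced // eqxx scale1r big1 ?addr0 ?subrr // => j
    /andP[rj jy].
by rewrite reduction_reduced // (negPf jy) scale0r.
Qed.

(** The trace of S A is the sum over x of the values at x of the rows x of S A.
    Expanding these in the functionals reduction z and exchanging the sums turns
    the row index x into an application of S to reduction z, which fixes it. *)
Lemma trace_formula r :
  \tr (map_mx (in_alg B) (Ssym N m F) *m (\big[@sconv _ / sone _]_(a < m) T a) r) =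
  \sum_(j : idx | reduced lo j) \sum_y reduction F lo j y *: legs t y j r.
Proof.
pose S (x y : idx) : F := Ssym N m F (rk x) (rk y).
have SE x : S x = ract (fun y => (x == y)%:R) (Ssym N m F).
  apply/funext=> y; rewrite /ract (bigD1 (rk x)) //= tindexK eqxx mul1r big1 ?addr0 //.
  move=> z; rewrite -[z]enum_valK /tindex => /negPf zx; rewrite enum_valK.
  by move: zx; rewrite (inj_eq enum_rank_inj) eq_sym => ->; rewrite mul0r.
have hS x : harmonic_tensor (row_legs t (S x)).
  apply: adjacent_harmonic => p q qp; rewrite SE.
  by apply: (row_legs_harmonic rtt F0 N_gt0) => //; apply: Ssym_harmonic N_gt0 _ _ _ _.
have -> : \tr (map_mx (in_alg B) (Ssym N m F) *m (\big[@sconv _ / sone _]_(a < m) T a) r)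
    = (\sum_x row_legs t (S x) x) r.
  have rkE (G : 'I_#|tbasis N m| -> B) : \sum_i G i = \sum_(x : idx) G (rk x).
    rewrite (reindex (fun x : idx => rk x)) //.
    exact: (onW_bij _ (enum_rank_bij (tbasis N m))).
  rewrite /mxtrace rkE series_sum; apply: eq_bigr => x _.
  rewrite mxE rkE /row_legs series_sum; apply: eq_bigr => y _.
  by rewrite mxE Top_prodE seriesZ mulr_algl.
under eq_bigr do rewrite (harmonic_expand _ (hS _)).
rewrite exchange_big series_sum; apply: eq_bigr => j _ /=.
have ->: \sum_y reduction F lo j y *: legs t y j r =
    \sum_y ract (reduction F lo j) (Ssym N m F) y *: legs t y j r.
  by rewrite ract_Ssym_harmonic //; apply: reduction_harmonic.
rewrite series_sum.
under eq_bigr do rewrite seriesZ /row_legs series_sum scaler_sumr.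
rewrite exchange_big; apply: eq_bigr => y _ /=.
rewrite /ract scaler_suml (reindex (fun x : idx => rk x)) /=; last first.
  exact: (onW_bij _ (enum_rank_bij (tbasis N m))).
by apply: eq_bigr => x _; rewrite tindexK scalerA.
Qed.

End TraceFormula.

(** * Weights and the Harish-Chandra image *)

Section Weights.
Variables (F : fieldType) (N : nat) (B : algType F).
Variable t : 'I_N -> 'I_N -> nat -> B.
Hypothesis t0 : forall i j, t i j 0 = (i == j)%:R.
Hypothesis rtt : forall r s, rtt_defect t r s = 0.

Definition weight (k i : 'I_N) : F := (i == k)%:R - (i == rev_ord k)%:R.

Definition has_weight (k : 'I_N) (c : F) (y : B) :=
  t k k 1 * y - y * t k k 1 = c *: y.

(** The coefficient of u v^{-s} in the RTT relation, at the entry (k i, k j). *)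
Lemma gen_weight (k i j : 'I_N) s : has_weight k (weight k i - weight k j) (t i j s).
Proof.
pose E (M : 'M[B]_(#|tbasis N 2|)) := M (tpair k i) (tpair k j).
have EB M M' : E (M - M') = E M - E M' by rewrite /E !mxE.
have := congr1 E (comm_T1 t0 rtt s); rewrite /= !EB /E.
have /= -> := T12_pair t 1 s k i k j; have /= -> := T21_pair t 1 s k i k j.
rewrite PopM_pair mulPop_pair QopM_pair mulQop_pair !Top1_pair /entry12 /entry21 !addn0.
have -> : \sum_c Top ord_max t s (tpair c (rev_ord c)) (tpair k j) = t (rev_ord k) j s.
  rewrite (bigD1 k) //= big1 ?addr0 => [|c /negPf ck]; last first.
    by rewrite Top1_pair ck mulr0.
  by rewrite Top1_pair eqxx mulr1.
have -> : \sum_c Top ord_max t s (tpair k i) (tpair c (rev_ord c)) = t i (rev_ord k) s.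
  rewrite (bigD1 k) //= big1 ?addr0 => [|c /negPf ck]; last first.
    by rewrite Top1_pair eq_sym ck mulr0.
  by rewrite Top1_pair eqxx mulr1.
rewrite /has_weight => ->; rewrite /weight !scalerBl !scaler_nat [k == j]eq_sym.
rewrite !mulr_natl !mulr_natr.
have e1 : t k j s *+ (i == k) = t i j s *+ (i == k) by case: eqP => // ->.
have e2 : t i k s *+ (j == k) = t i j s *+ (j == k) by case: eqP => // ->.
have e3 : t (rev_ord k) j s *+ (i == rev_ord k) = t i j s *+ (i == rev_ord k).
  by case: eqP => // ->.
have e4 : t i (rev_ord k) s *+ (j == rev_ord k) = t i j s *+ (j == rev_ord k).
  by case: eqP => // ->.
by rewrite e1 e2 e3 e4 !opprB addrACA [RHS]addrACA; congr (_ + _); rewrite addrC.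
Qed.

Lemma has_weight0 k c : has_weight k c 0.
Proof. by rewrite /has_weight mulr0 mul0r subrr scaler0. Qed.

Lemma has_weight1 k : has_weight k 0 1.
Proof. by rewrite /has_weight mulr1 mul1r subrr scale0r. Qed.

Lemma has_weightD k c x y :
  has_weight k c x -> has_weight k c y -> has_weight k c (x + y).
Proof.
by rewrite /has_weight => hx hy; rewrite mulrDr mulrDl opprD addrACA hx hy scalerDr.
Qed.

Lemma has_weightZ k c e x : has_weight k c x -> has_weight k c (e *: x).
Proof.
by rewrite /has_weight -scalerAr -scalerAl -scalerBr => ->; rewrite !scalerA mulrC.
Qed.

Lemma has_weightM k c d x y :
  has_weight k c x -> has_weight k d y -> has_weight k (c + d) (x * y).
Proof.
rewrite /has_weight => hx hy; rewrite scalerDl scalerAl -hx scalerAr -hy.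
by rewrite mulrBl mulrBr !mulrA addrA subrK.
Qed.

Lemma has_weight_sum k c I (s : seq I) (P : pred I) (f : I -> B) :
  (forall i, P i -> has_weight k c (f i)) -> has_weight k c (\sum_(i <- s | P i) f i).
Proof.
move=> h; elim/big_rec: _ => [|i x Pi hx]; first exact: has_weight0.
exact: has_weightD (h _ Pi) hx.
Qed.

Lemma legs_weight m (s : seq 'I_m) (x y : {ffun 'I_m -> 'I_N}) k r :
  has_weight k (\sum_(a <- s) (weight k (x a) - weight k (y a))) ((\prod_(a <- s) leg t
      a x y) r).
Proof.
elim: s r => [|a s IH] r.
  rewrite !big_nil -[(1 : series B) r]/(sone B r) /sone.
  by case: (r == 0%N); [apply: has_weight1|apply: has_weight0].
rewrite !big_cons seriesM; apply: has_weight_sum => i _; apply: has_weightM => //.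
by apply: has_weight_sum => j _; apply: has_weightZ; apply: gen_weight.
Qed.

End Weights.

Section Chi.
Variables (F : fieldType) (N : nat).
Hypothesis (F0 : [pchar F] =i pred0).
Local Notation Y := (yangian F N).
Local Notation t := (@ygen F N).
Variable chi : {lrmorphism hinvariant F N -> hcpoly F N}.
Hypothesis chi_hc : is_harish_chandra chi.

(** The Harish-Chandra map is defined on a subtype; as a relation on the Yangian it
    is compatible with sums and products without any proof of invariance to
    carry along. *)
Definition hc_image (y : Y) (c : hcpoly F N) := exists2 h, hval h = y & chi h = c.

Lemma hc_image1 : hc_image 1 1.
Proof. by exists 1; rewrite ?rmorph1. Qed.

Lemma hc_image0 : hc_image 0 0.
Proof. by exists 0; rewrite ?raddf0. Qed.

Lemma hc_imageD x y c d : hc_image x c -> hc_image y d -> hc_image (x + y) (c + d).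
Proof. by case=> h <- <- [h' <- <-]; exists (h + h'); rewrite ?raddfD. Qed.

Lemma hc_imageM x y c d : hc_image x c -> hc_image y d -> hc_image (x * y) (c * d).
Proof. by case=> h <- <- [h' <- <-]; exists (h * h'); rewrite ?rmorphM. Qed.

Lemma hc_imageZ e x c : hc_image x c -> hc_image (e *: x) (e *: c).
Proof. by case=> h <- <-; exists (e *: h); rewrite ?linearZ. Qed.

Lemma hc_image_sum I (s : seq I) (P : pred I) (f : I -> Y) g :
  (forall i, P i -> hc_image (f i) (g i)) ->
  hc_image (\sum_(i <- s | P i) f i) (\sum_(i <- s | P i) g i).
Proof.
move=> h; elim/big_rec2: _ => [|i c x Pi hx]; first exact: hc_image0.
exact: hc_imageD (h _ Pi) hx.
Qed.

Lemma hc_image_kernel y : (forall k, has_weight t k 0 y) ->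
  left_ideal (@upper_gen F N) y -> hc_image y 0.
Proof.
move=> hw hI; have hy : y \in hinv.
  by apply/asboolP=> i; rewrite hw scale0r.
by exists (HInvariant hy) => //; apply/(hc_ker chi_hc).
Qed.

Definition hc_series (f : series Y) (g : series (hcpoly F N)) :=
  forall r, hc_image (f r) (g r).

Lemma hc_seriesM f g f' g' :
  hc_series f g -> hc_series f' g' -> hc_series (f * f') (g * g').
Proof. by move=> h h' r; apply: hc_image_sum => i _; apply: hc_imageM. Qed.

Variable m : nat.
Local Notation idx := {ffun 'I_m -> 'I_N}.

Definition hc_leg (a : 'I_m) (y : idx) : series (hcpoly F N) :=
  sshift (a%:R : F) (lambda chi (y a)).

Lemma hc_series_diag (s : seq 'I_m) (y : idx) :
  hc_series (\prod_(a <- s) leg t a y y) (\prod_(a <- s) hc_leg a y).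
Proof.
elim/big_rec2: _ => [|a f g _ h].
  move=> r; rewrite -[(1 : series Y) r]/(sone Y r) -[(1 : series _) r]/(sone _ r) /sone.
  by case: (r == 0%N); [apply: hc_image1|apply: hc_image0].
apply: hc_seriesM => // r; apply: hc_image_sum => i _; apply: hc_imageZ.
by exists (hdiag F (y a) i).
Qed.

Lemma left_ideal_sum I (s : seq I) (f : I -> Y) :
  (forall i, left_ideal (@upper_gen F N) (f i)) ->
  left_ideal (@upper_gen F N) (\sum_(i <- s) f i).
Proof.
by move=> h; elim/big_rec: _ => [|i x _ hx]; [exact: LI0|exact: LID].
Qed.

Variable lo : 'I_N.
Hypothesis lo_lt_hi : (lo < rev_ord lo)%N.
Hypothesis outer : forall v, v != lo -> v != rev_ord lo ->
  (rev_ord lo < v)%N || (rev_ord lo < rev_ord v)%N.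

(** The product is split after the last place p where y and z differ.  The first
    part has weight zero because y and z have the same weight and agree after p,
    and its last factor t_{y_p z_p} with y_p < z_p puts it into the left ideal.
    The second part is diagonal. *)
Lemma hc_legs_offdiag (z y : idx) r : reduction F lo z y != 0 -> reduced lo z -> y != z ->
  hc_image (legs t y z r) 0.
Proof.
move=> rzy rz yz; have [p yp tail] := reduction_dominance lo_lt_hi outer rzy rz yz.
have [_ sw _] := reduction_rec_rel lo_lt_hi outer (leqnn _) rzy.
pose s1 := take p.+1 (enum 'I_m); pose s2 := drop p.+1 (enum 'I_m).
have tail2 a : a \in s2 -> y a = z a by move=> /enum_drop_ge; apply: tail.
have -> : legs t y z = (\prod_(a <- s1) leg t a y z) * (\prod_(a <- s2) leg t a z z).
  rewrite /legs -[index_enum _]enumT -(cat_take_drop p.+1 (enum _)) big_cat.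
  by congr (_ * _); apply: eq_big_seq => a /tail2; rewrite /leg => ->.
have -> : 0 = ((0 : series (hcpoly F N)) * \prod_(a <- s2) hc_leg a z) r.
  by rewrite mul0r.
apply: hc_seriesM; last exact: hc_series_diag.
move=> k {r}; apply: hc_image_kernel => [j|].
  rewrite (_ : 0 = \sum_(a <- s1) (weight F j (y a) - weight F j (z a))).
    exact: (legs_weight (@ygen0 F N) (@ygen_rtt F N)).
  transitivity (\sum_a (weight F j (y a) - weight F j (z a))); last first.
    rewrite -[index_enum _]enumT -(cat_take_drop p.+1 (enum _)) big_cat /=.
    rewrite [X in _ + X]big1_seq ?addr0 // => a /andP[_ /tail2 ->].
    by rewrite subrr.
  have wtE (x : idx) : \sum_a weight F j (x a) = (content x j)%:R - (content x (rev_ord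
      j))%:R.
    by rewrite !ffunE !natr_sum -sumrB.
  by rewrite sumrB !wtE opprB addrACA -natrD sw natrD -opprD subrr.
have -> : s1 = rcons (take p (enum 'I_m)) p.
  by rewrite /s1 (take_nth p) ?size_enum_ord // nth_ord_enum.
rewrite big_rcons /= seriesM.
apply: left_ideal_sum => i; apply: LIM.
rewrite /leg /sshift; apply: left_ideal_sum => j; rewrite -mulr_algl; apply: LIM.
(* The coefficient of u^0 is 0, since y_p differs from z_p. *)
case: (nat_of_ord j) => [|r]; last by apply: LIgen; exists (y p), (z p), r.
by rewrite ygen0 -val_eqE /= ltn_eqF //; exact: LI0.
Qed.

End Chi.

Lemma trace_image (F : fieldType) (N m : nat) (F0 : [pchar F] =i pred0) (lo : 'I_N)
  (lo_lt_hi : (lo < rev_ord lo)%N)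
  (outer : forall v, v != lo -> v != rev_ord lo ->
     (rev_ord lo < v)%N || (rev_ord lo < rev_ord v)%N)
  (chi : {lrmorphism hinvariant F N -> hcpoly F N}) (chi_hc : is_harish_chandra chi) r :
  hc_image chi
   (\tr (map_mx (in_alg (yangian F N)) (Ssym N m F) *m
     (\big[@sconv _ / sone _]_(a < m) Top a (fun i j => sshift a%:R (ygen F i j))) r))
   (\sum_(y : {ffun 'I_m -> 'I_N} | reduced lo y) (\prod_a hc_leg chi a y) r).
Proof.
rewrite (trace_formula m (@ygen_rtt F N) F0 lo_lt_hi).
apply: hc_image_sum => z rz.
rewrite (bigD1 z) //= -[X in hc_image _ _ X]addr0; apply: hc_imageD.
  by rewrite reduction_reduced // eqxx scale1r; apply: hc_series_diag.
have <- : \sum_(y : {ffun 'I_m -> 'I_N} | y != z) (0 : hcpoly F N) = 0 by rewrite big1.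
apply: hc_image_sum => y yz.
have [->|rzy] := eqVneq (reduction F lo z y) 0; first by rewrite scale0r; apply: hc_image0.
rewrite -(scaler0 (hcpoly F N) (reduction F lo z y)); apply: hc_imageZ.
exact: (hc_legs_offdiag chi_hc lo_lt_hi outer).
Qed.

Theorem proposition2p3 (R : realType) (N n m : nat)
  (N_even : N = n.*2) (n_gt0 : (0 < n)%N) (m_gt0 : (0 < m)%N)
  (chi : {lrmorphism hinvariant R[i] N -> hcpoly R[i] N})
  (chi_hc : is_harish_chandra chi) :
  let Y := yangian R[i] N in
  let T (a : 'I_m) : nat -> 'M[Y]_(#|tbasis N m|) :=
    Top a (fun i j => sshift a%:R (ygen R[i] i j)) in
  let trST : nat -> Y := fun r =>
    \tr (map_mx (in_alg Y) (Ssym N m R[i])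
           *m (\big[@sconv _ / sone _]_(a < m) T a) r) in
  forall r : nat,
    exists tr_hinv : trST r \in hinv,
      chi (HInvariant tr_hinv) =
      \sum_(i : {ffun 'I_m -> 'I_N} |
              [forall a : 'I_m, forall b : 'I_m,
                 (a <= b)%N ==> (i a <= i b)%N]
              && ~~ ([exists a : 'I_m, i a == n.-1 :> nat]
                     && [exists a : 'I_m, i a == n :> nat]))
         (\big[@sconv _ / sone _]_(a < m) sshift a%:R (lambda chi (i a))) r.
Proof.
move=> Y T trST r.
have loN : (n.-1 < N)%N by rewrite N_even -addnn prednK // leq_addr.
pose lo : 'I_N := Ordinal loN.
have hiE : rev_ord lo = n :> nat by rewrite /= prednK // N_even -addnn addnK.
have lo_lt_hi : (lo < rev_ord lo)%N by rewrite hiE /= prednK.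
have outer (v : 'I_N) : v != lo -> v != rev_ord lo ->
    (rev_ord lo < v)%N || (rev_ord lo < rev_ord v)%N.
  rewrite -!val_eqE [val (rev_ord lo)]hiE [nat_of_ord (rev_ord lo)]hiE /=.
  have NE : (N = n + n)%N by rewrite N_even addnn.
  by move: (nat_of_ord v) (ltn_ord v) => w; clear -n_gt0 NE; lia.
have [h hE chE] := trace_image m (@Num.Theory.pchar_num R[i]) lo_lt_hi outer chi_hc r.
have tr_hinv : trST r \in hinv by rewrite /trST -hE (hvalP h).
exists tr_hinv; have -> : HInvariant tr_hinv = h by apply: val_inj; rewrite /= hE.
rewrite chE; apply: eq_bigl => y; rewrite /reduced; congr (_ && ~~ (_ && _)).
by apply: eq_existsb => a; rewrite -val_eqE [X in _ == X]hiE.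
Qed.
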